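(* Let $\Omega\subset\mathbb{C}^m$ be a Carathéodory hyperbolic domain. Fix mutually distinct points $z_1,\ldots,z_n\in\Omega$, put $\underline{z}=(z_1,\ldots,z_n)$, and fix a nonzero $\underline{\alpha}=(\alpha_1,\ldots,\alpha_n)\in\mathbb{C}^n$ with $\alpha_i\ne\alpha_j$ for some $i,j$. Then the following are equivalent. (1) For some $i,j$ with $\alpha_i\neq\alpha_j$, the infimum defining $\delta^{\Omega}_{(\underline{z},\underline{\alpha})}(z_i,z_j)$ is attained and $d^{\Omega}_{(\underline{z},\underline{\alpha})}(z_i,z_j)=\delta^{\Omega}_{(\underline{z},\underline{\alpha})}(z_i,z_j)$. (2) There are a map $\phi\in\mathcal{O}(\mathbb{D},\Omega)$ and a function $f\in\mathcal{O}(\Omega,\mathbb{D})$ such that $(f(z_1),\ldots,f(z_n))\in\mathbb{C}\cdot\underline{\alpha}$, $z_1,\ldots,z_n\in\phi(\mathbb{D})$, and $f\circ\phi$ is a non-constant Blaschke product of degree at most $n-1$. Moreover, if the property in (1) (attainment of the infimum and the equality) holds for one pair $(i,j)$ with $\alpha_i\ne\alpha_j$, then it holds for all $i$ and $j$.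
   Context: $\mathbb{D}$ is the open unit disc in $\mathbb{C}$; $\mathcal{O}(X,Y)$ is the set of holomorphic maps $X\to Y$. For $u,v\in\mathbb{D}$, $m(u,v)=\left|\frac{u-v}{1-\overline{u}v}\right|$. A domain $\Omega\subset\mathbb{C}^m$ ($m\ge1$) is Carathéodory hyperbolic if $c^*_\Omega(z,w)=\sup\{m(g(z),g(w)):g\in\mathcal{O}(\Omega,\mathbb{D})\}>0$ for all distinct $z,w\in\Omega$. For $\underline{z}=(z_1,\ldots,z_n)\in\Omega^n$ and $\underline{\alpha}\in\mathbb{C}^n\setminus\{\mathbf 0\}$ define $$d^{\Omega}_{(\underline{z},\underline{\alpha})}(z_i,z_j)=\sup\{m(f(z_i),f(z_j)): f\in\mathcal{O}(\Omega,\mathbb{D}),\ (f(z_1),\ldots,f(z_n))\in\mathbb{C}\cdot\underline{\alpha}\},$$ where $\mathbb{C}\cdot\underline{\alpha}$ is the one-dimensional subspace spanned by $\underline{\alpha}$, and $$\delta^{\Omega}_{(\underline{z},\underline{\alpha})}(z_i,z_j)=\inf\{d^{\mathbb{D}}_{(\underline{\lambda},\underline{\alpha})}(\lambda_i,\lambda_j): \underline{\lambda}=(\lambda_1,\ldots,\lambda_n)\in\mathbb{D}^n,\ \phi(\lambda_k)=z_k\ (1\le k\le n)\text{ for some }\phi\in\mathcal{O}(\mathbb{D},\Omega)\}.$$ *)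

(* Defs.v *)
From HB Require Import structures.
From mathcomp Require Import all_boot all_order all_algebra.
From mathcomp Require Import complex.
From mathcomp Require Import all_classical all_reals all_analysis.
Set Implicit Arguments.
Unset Strict Implicit.
Unset Printing Implicit Defensive.
Import Order.TTheory GRing.Theory Num.Theory.
Import numFieldNormedType.Exports.
Local Open Scope classical_set_scope.
Local Open Scope ring_scope.

(* R[i]^o is the complex numbers as a one-dimensional normed space over R[i],
   and 'rV[R[i]^o]_m is C^m; over the scalars R[i], [differentiable] means
   complex differentiable. *)

Definition disc (R : realType) : set R[i]^o := [set w | `|w| < 1].
Arguments disc : clear implicits.

Definition domain (R : realType) (V : normedModType R[i]) (X : set V) : Prop :=
  [/\ X !=set0, open X & connected X].

(* Holomorphic maps X -> Y, for X open. The elements are total functions,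
   whose values outside X are irrelevant. *)
Definition holo (R : realType) (V W : normedModType R[i])
    (X : set V) (Y : set W) : set (V -> W) :=
  [set f | (forall x, X x -> differentiable f x) /\
           (forall x, X x -> Y (f x))].

Definition mobius_dist (R : realType) (u v : R[i]) : R :=
  Normc.normc ((u - v) / (1 - u^* * v)).

Definition caratheodory_dist (R : realType) (V : normedModType R[i])
    (X : set V) (z w : V) : R :=
  sup [set mobius_dist (g z) (g w) | g in holo X (disc R)].

Definition caratheodory_hyperbolic (R : realType) (V : normedModType R[i])
    (X : set V) : Prop :=
  forall z w : V, X z -> X w -> z <> w -> 0 < caratheodory_dist X z w.

Definition values_in_line (R : realType) (V : normedModType R[i]) (n : nat)
    (z : 'I_n -> V) (alpha : 'rV[R[i]]_n) (f : V -> R[i]^o) : Prop :=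
  exists c : R[i], \row_k (f (z k) : R[i]) = c *: alpha.

(* The set below is bounded by 1, and contains 0 (take f = 0). *)
Definition d_dist (R : realType) (V : normedModType R[i]) (X : set V) (n : nat)
    (z : 'I_n -> V) (alpha : 'rV[R[i]]_n) (i j : 'I_n) : R :=
  sup [set mobius_dist (f (z i)) (f (z j)) |
        f in [set f | holo X (disc R) f /\ values_in_line z alpha f]].

Definition liftings (R : realType) (V : normedModType R[i]) (X : set V)
    (n : nat) (z : 'I_n -> V) : set ('I_n -> R[i]^o) :=
  [set lambda | (forall k, disc R (lambda k)) /\
     exists2 phi : R[i]^o -> V, holo (disc R) X phi
       & forall k, phi (lambda k) = z k].

Definition delta_dist (R : realType) (V : normedModType R[i]) (X : set V)
    (n : nat) (z : 'I_n -> V) (alpha : 'rV[R[i]]_n) (i j : 'I_n) : R :=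
  inf [set d_dist (disc R) lambda alpha i j | lambda in liftings X z].

(* Attainment provides a lifting, so the convention inf set0 = 0 cannot make
   it hold vacuously. *)
Definition delta_attained (R : realType) (V : normedModType R[i]) (X : set V)
    (n : nat) (z : 'I_n -> V) (alpha : 'rV[R[i]]_n) (i j : 'I_n) : Prop :=
  exists2 lambda, liftings X z lambda
    & d_dist (disc R) lambda alpha i j = delta_dist X z alpha i j.

Definition attained_equality (R : realType) (V : normedModType R[i])
    (X : set V) (n : nat) (z : 'I_n -> V) (alpha : 'rV[R[i]]_n)
    (i j : 'I_n) : Prop :=
  delta_attained X z alpha i j /\
  d_dist X z alpha i j = delta_dist X z alpha i j.

Definition blaschke_product (R : realType) (d : nat) (B : R[i]^o -> R[i]^o) :
    Prop :=
  exists (c : R[i]) (a : 'I_d -> R[i]),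
    [/\ `|c| = 1, forall k, disc R (a k)
      & forall w : R[i], disc R w ->
          B w = c * \prod_(k < d) ((w - a k) / (1 - (a k)^* * w))].

Definition nonconstant_on (T U : Type) (X : set T) (f : T -> U) : Prop :=
  exists x y, [/\ X x, X y & f x <> f y].

(* Main.v *)
From HB Require Import structures.
Require Import Defs.
From mathcomp Require Import all_boot all_order all_algebra.
From mathcomp Require Import complex ring lra.
From mathcomp Require Import all_classical all_reals all_analysis.
Set Implicit Arguments.
Unset Strict Implicit.
Unset Printing Implicit Defensive.
Import Order.TTheory GRing.Theory Num.Theory.
Import numFieldNormedType.Exports.
Local Open Scope classical_set_scope.
Local Open Scope ring_scope.

Import Normc.

(** Write f(z_k) = c alpha_k for a competitor f in the definition of d.  For
    alpha_i <> alpha_j the pseudo-hyperbolic distance of c alpha_i and c alpha_j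
    is a strictly increasing function of |c| ([mobius_scale_lt]), so maximising
    the distance of one such pair is the same as maximising |c|, hence as
    maximising the distance of all pairs at once.  Composition with a map phi
    from D to X gives d^X <= d^D(lambda) for every lifting lambda through phi, so
    d^X <= delta as soon as there is a lifting.

    From a Blaschke product to equality: let B = f o phi have degree at most
    n - 1 and values c alpha_k at lambda_k.  If some g from D to D had values
    c' alpha_k with |c'| > |c|, then (c/c') g would be bounded by |c/c'| < 1 and
    agree with B at n points.  Peeling off one common point at a time with
    Schwarz's lemma lowers the degree of B until it is a unimodular constant,
    which is absurd ([blaschke_interpolation_rigid]).  Hence f o phi is extremal
    for lambda, and d^X <= delta <= d^D(lambda) = m(c alpha_i, c alpha_j) <= d^X.

    From equality to a Blaschke product: a normal family argument yields an
    extremal f on X ([extremal_exists]).  If d^X = d^D(lambda) for a lifting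
    lambda through phi, then f o phi is extremal on the disc.  The Schur algorithm
    ([interpolation_dichotomy]) shows that a self-map g of the disc is either a
    Blaschke product of degree less than n, or can be replaced by another one
    taking any prescribed values close to g(lambda_k); in the second case one
    prescribes a multiple of alpha with larger |c|, contradicting extremality
    ([extremal_blaschke]).

    The function theory rests on complex differentiability alone.  Goursat's
    bisection is carried out for trapezoid sums along segments ([goursat]).
    Pulled back by the exponential, under which circles around 0 correspond to
    vertical segments of length 2 pi, it bounds f(0) by the values of f near the
    unit circle ([mean_bound]); Moebius maps move 0 to any point
    ([maximum_principle]).  Taking high powers
    makes the principle insensitive to finitely many points where f is only
    continuous ([maximum_principle_exceptional]), and applied to divided
    differences this gives removable singularities ([removable_singularity]) and
    Schwarz's lemma ([schwarz_quotient]).  Schwarz's lemma used twice is a Taylor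
    estimate with uniform constants, which survives pointwise limits: this is the
    compactness of bounded holomorphic functions ([montel_ultra_limit]). *)

Local Notation N := Normc.normc.
Local Notation Re := complex.Re.
Local Notation Im := complex.Im.
Local Notation cdiff f p :=
  (differentiable (f : (complex _)^o -> (complex _)^o) (p : (complex _)^o)).

(** * The modulus of a complex number as a real number *)

Section NormC.
Variable R : realType.
Implicit Types (x y : R[i]).

Lemma normr_normc x : `|x| = (N x)%:C%C. Proof. by case: x. Qed.

Lemma normc_ge0 x : 0 <= N x. Proof. by case: x => a b; exact: sqrtr_ge0. Qed.

Lemma normcX x k : N (x ^+ k) = N x ^+ k.
Proof. by elim: k => [|k IH]; rewrite ?expr0 ?normc1 // !exprS normcM IH. Qed.

Lemma le_normcB x y : N (x - y) <= N x + N y.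
Proof. by rewrite -(normcN y); exact: le_normcD. Qed.

Lemma normcBC x y : N (x - y) = N (y - x). Proof. by rewrite -normcN opprB. Qed.

Lemma lerB_normcB x y : N x - N y <= N (x - y).
Proof. by rewrite lerBlDr; apply: le_trans (le_normcD _ _); rewrite subrK. Qed.

Lemma normc_triangle z x y : N (x - y) <= N (x - z) + N (z - y).
Proof. by apply: le_trans (le_normcD _ _); rewrite addrA subrK. Qed.

Lemma normc_eq0 x : (N x == 0) = (x == 0).
Proof. by apply/eqP/eqP => [/Normc.eq0_normc//|->]; rewrite normc0. Qed.

Lemma normc_gt0 x : (0 < N x) = (x != 0).
Proof. by rewrite lt0r normc_eq0 normc_ge0 andbT. Qed.

Lemma normc_real (a : R) : N a%:C%C = `|a|.
Proof. by rewrite /= expr0n addr0 sqrtr_sqr. Qed.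

Lemma normc_nat k : N (k%:R : R[i]) = k%:R.
Proof. by rewrite -[k%:R](rmorph_nat (real_complex R)) normc_real normr_nat. Qed.

Lemma normc_i : N ('i%C : R[i]) = 1.
Proof. by rewrite /= expr0n add0r expr1n sqrtr1. Qed.

Lemma conj_conjc x : x^* = conjc x. Proof. by []. Qed.

Lemma normc_conj x : N x^* = N x.
Proof. by case: x => a b; rewrite conj_conjc /= sqrrN. Qed.

Lemma sqr_normc_conj x : (N x ^+ 2)%:C%C = x * x^*.
Proof. by rewrite -normCK normr_normc -rmorphXn. Qed.

Lemma sqr_normcE x : N x ^+ 2 = Re x ^+ 2 + Im x ^+ 2.
Proof. by case: x => a b /=; rewrite sqr_sqrtr // addr_ge0 ?sqr_ge0. Qed.

Lemma normr_lt_normc x (r : R) : (`|x| < r%:C%C) = (N x < r).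
Proof. by rewrite normr_normc ltcR. Qed.

Lemma disc_normc (w : R[i]^o) : disc R w = (N w < 1).
Proof. by rewrite /disc /= -(normr_lt_normc (w : R[i]) 1). Qed.

Lemma Re_le_normc x : `|Re x| <= N x.
Proof. by have := normc_ge_Re x; rewrite normr_normc lecR. Qed.

Lemma Im_le_normc x : `|Im x| <= N x.
Proof.
case: x => a b /=; rewrite -sqrtr_sqr ler_wsqrtr // lerDr sqr_ge0 //.
Qed.

Lemma normc_le_ReIm x : N x <= `|Re x| + `|Im x|.
Proof.
case: x => a b; have -> : (a +i* b)%C = a%:C%C + 'i%C * b%:C%C.
  by rewrite [LHS]complexE.
apply: le_trans (le_normcD _ _) _; rewrite normcM normc_i mul1r.
by rewrite !normc_real /= !(mul0r, mulr0, subr0, addr0, add0r, mul1r).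
Qed.

End NormC.

(** * Norms and differentials with real error terms *)

Section Nrm.
Variable R : realType.

(** The norm of a complex normed module takes its values among the nonnegative
    elements of the partially ordered field R[i]; estimates are simpler in R. *)
Definition nrm (V : normedModType R[i]) (v : V) : R := Re `|v|.

Section NrmV.
Variable V : normedModType R[i].
Implicit Types v w : V.

Lemma nrmE v : `|v| = (nrm v)%:C%C.
Proof. by have := ger0_Im (normr_ge0 v); rewrite /nrm; case: `|v| => a b /= ->. Qed.

Lemma nrm_ge0 v : 0 <= nrm v.
Proof. by rewrite -ler0c -nrmE. Qed.

Lemma nrmD v w : nrm (v + w) <= nrm v + nrm w.
Proof. by rewrite -lecR rmorphD /= -!nrmE; exact: ler_normD. Qed.

Lemma nrmN v : nrm (- v) = nrm v.
Proof. by rewrite /nrm normrN. Qed.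

Lemma nrmZ a v : nrm (a *: v) = N a * nrm v.
Proof.
by apply: (@complexI R); rewrite rmorphM /= -!nrmE -normr_normc normrZ.
Qed.

Lemma nrm0 : nrm (0 : V) = 0. Proof. by rewrite /nrm normr0. Qed.

Lemma nrm_eq0 v : (nrm v == 0) = (v == 0).
Proof.
apply/eqP/eqP => [h|->]; last exact: nrm0.
by apply/eqP; rewrite -normr_eq0 nrmE h.
Qed.

Lemma nrm_gt0 v : (0 < nrm v) = (v != 0).
Proof. by rewrite lt0r nrm_eq0 nrm_ge0 andbT. Qed.

Lemma real_posP (e : R[i]) : 0 < e -> exists2 d : R, 0 < d & e = d%:C%C.
Proof.
case: e => a b; rewrite ltcE /= => /andP[/eqP -> a0]; exists a => //.
Qed.

Lemma near0_nrm (P : V -> Prop) :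
  (\forall x \near (0 : V), P x) <->
  exists2 d : R, 0 < d & forall x, nrm x < d -> P x.
Proof.
split=> [/nbhs_norm0P [e /= /real_posP[d d0 ->] h]|[d d0 h]].
  by exists d => // x xd; apply: h => /=; rewrite nrmE ltcR.
apply/nbhs_norm0P; exists d%:C%C => /=; first by rewrite ltcR.
by move=> x /=; rewrite nrmE ltcR; exact: h.
Qed.

Lemma near_nrm (p : V) (P : V -> Prop) :
  (\forall x \near p, P x) <->
  exists2 d : R, 0 < d & forall x, nrm (x - p) < d -> P x.
Proof.
split=> [/nbhs0P/near0_nrm [d d0 h]|[d d0 h]].
  by exists d => // x xd; have := h _ xd; rewrite addrC subrK.
by apply/nbhs0P/near0_nrm; exists d => // x xd; apply: h; rewrite addrC addKr.
Qed.

End NrmV.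

Lemma nrmC (z : R[i]^o) : nrm z = N z.
Proof. by apply: (@complexI R); rewrite -nrmE; exact: normr_normc. Qed.

Section Diff.
Variables V W : normedModType R[i].
Implicit Types (f : V -> W) (p h : V).

Lemma diff_eps f p : differentiable f p -> forall e : R, 0 < e ->
  exists2 d : R, 0 < d &
    forall h, nrm h < d -> nrm (f (p + h) - f p - 'd f p h) <= e * nrm h.
Proof.
move=> /diff_locallyP [_ /eqaddoP H] e e0.
have /H /near0_nrm[d d0 hd] : 0 < e%:C%C by rewrite ltcR.
exists d => // h /hd /=; rewrite !fctE /= !nrmE -rmorphM lecR.
by rewrite [h + p]addrC opprD addrA.
Qed.

(** Uniqueness of the differential: any bounded linear map with an error term
    of order o(h) is the differential. *)
Lemma diff_from_eps f p (L : {linear V -> W}) (C : R) :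
  (forall h, nrm (L h) <= C * nrm h) ->
  (forall e : R, 0 < e -> exists2 d : R, 0 < d &
    forall h, nrm h < d -> nrm (f (p + h) - f p - L h) <= e * nrm h) ->
  differentiable f p.
Proof.
move=> LC H.
have Lc : continuous L.
  apply: bounded_linear_continuous; apply/bounded_funP => r.
  exists (`|C|%:C%C * r) => x xr; apply: (@le_trans _ _ (`|C|%:C%C * `|x|)).
    rewrite !nrmE -rmorphM lecR; apply: le_trans (LC x) _.
    by apply: ler_wpM2r; [exact: nrm_ge0|exact: ler_norm].
  by apply: ler_wpM2l => //; rewrite ler0c.
have Le : f \o shift p = cst (f p) + L +o_ 0 id.
  apply/eqaddoP => _ /= /real_posP [e e0 ->].
  have [d d0 hd] := H e e0.
  apply/near0_nrm; exists d => // h /hd; rewrite !fctE /= !nrmE -rmorphM lecR.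
  by rewrite [h + p]addrC opprD addrA.
by apply/diff_locallyP; rewrite (diff_unique Lc Le).
Qed.

Lemma diff_cont_eps f p : differentiable f p -> forall e : R, 0 < e ->
  exists2 d : R, 0 < d & forall x, nrm (x - p) < d -> nrm (f x - f p) < e.
Proof.
move=> /differentiable_continuous fc e e0.
have e0' : 0 < e%:C%C by rewrite ltcR.
move: fc => /cvgrPdistC_lt /(_ _ e0') /near_nrm [d d0 h].
by exists d => // x /h; rewrite nrmE ltcR.
Qed.

End Diff.

Lemma cdiff_eps (f : R[i]^o -> R[i]^o) (p : R[i]^o) : differentiable f p ->
  exists l : R[i], forall e : R, 0 < e ->
  exists2 d : R, 0 < d & forall z : R[i], N (z - p) < d ->
     N (f z - f p - l * (z - p)) <= e * N (z - p).
Proof.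
move=> fd; exists ('d f p 1) => e /(diff_eps fd) [d d0 H]; exists d => // z zd.
have := H (z - p); rewrite nrmC => /(_ zd); rewrite nrmC.
rewrite [p + _]addrC subrK.
have -> : 'd f p (z - p) = 'd f p 1 * (z - p) :> R[i].
  by rewrite -[X in 'd f p X]mulr1 (linearZ _ (1:R[i]^o)) mulrC.
by [].
Qed.

Lemma cdiff_from_eps (f : R[i]^o -> R[i]^o) (p : R[i]^o) (l : R[i]) :
  (forall e : R, 0 < e ->
  exists2 d : R, 0 < d & forall z : R[i], N (z - p) < d ->
     N (f z - f p - l * (z - p)) <= e * N (z - p)) -> differentiable f p.
Proof.
move=> H.
pose L (h : R[i]^o) : R[i]^o := h *: (l : R[i]^o).
have Ll : linear L by move=> a u v; rewrite /L scalerDl scalerA.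
pose LL : {linear R[i]^o -> R[i]^o} :=
  HB.pack L (GRing.isLinear.Build _ _ _ _ L Ll).
apply: (@diff_from_eps _ _ _ _ LL (N l)) => [h|e /H [d d0 hd]].
  by rewrite !nrmC /= normcM mulrC.
exists d => // h; rewrite !nrmC => hh.
by have := hd (p + h); rewrite [p + h - p]addrC addKr => /(_ hh); rewrite mulrC.
Qed.

End Nrm.

(** * Limits along an ultrafilter on the natural numbers *)

Section UltraLimit.
Variable R : realType.
Variable U : set_system nat.
Context {UU : UltraFilter U}.

(** A cluster point of the sequence is its limit along U, since an ultrafilter
    contains each set of indices or its complement. *)
Lemma real_ultra_limit (a : nat -> R) (M : R) : (forall n, `|a n| <= M) ->
  exists p, forall e : R, 0 < e -> U [set n | `|a n - p| < e].
Proof.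
move=> aM.
have cS : compact `[-M, M]%classic by exact: segment_compact.
have [|p [pS pc]] := cS (a @ U) _.
  have : U (a @^-1` `[-M, M]%classic); last by [].
  apply: filterS (@filterT _ U _) => n _.
  by rewrite /= in_itv /= -ler_norml.
exists p => e e0.
case: (in_ultra_setVsetC [set n | `|a n - p| < e] UU) => // UC; exfalso.
have Bp : nbhs p (ball p e) by exact: nbhsx_ballx.
have [_ [/= [n nc <-] nb]] :
   (a @` (~` [set n | `|a n - p| < e]) `&` ball p e) !=set0.
  apply: pc => //.
  have : U (a @^-1` (a @` (~` [set n | `|a n - p| < e]))); last by [].
  by apply: filterS UC => n nc /=; exists n.
by apply: nc => /=; rewrite distrC.
Qed.

(** Every bounded sequence converges along U, so limits can be taken at all
    points of a domain at once, without extracting subsequences. *)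
Lemma ultra_limit (a : nat -> R[i]) (M : R) : (forall n, N (a n) <= M) ->
  exists p, forall e : R, 0 < e -> U [set n | N (a n - p) < e].
Proof.
move=> aM.
have [p hp] := @real_ultra_limit (fun n => Re (a n)) M
  (fun n => le_trans (Re_le_normc _) (aM n)).
have [q hq] := @real_ultra_limit (fun n => Im (a n)) M
  (fun n => le_trans (Im_le_normc _) (aM n)).
exists (p +i* q)%C => e e0.
have e2 : 0 < e / 2 by lra.
apply: filterS2 (hp _ e2) (hq _ e2) => n /= h1 h2.
apply: le_lt_trans (normc_le_ReIm _) _; case: (a n) h1 h2 => x y /= h1 h2.
by lra.
Qed.

Lemma ultra_limit_le (a : nat -> R[i]) (p : R[i]) (b : R) (k : R[i]) :
  (forall e, 0 < e -> U [set n | N (a n - p) < e]) ->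
  U [set n | N (a n - k) <= b] -> N (p - k) <= b.
Proof.
move=> ap ak; apply/ler_addgt0Pr => e e0.
have [n [/= h1 h2]] := filter_ex (filterI ak (ap _ e0)).
apply: le_trans (normc_triangle (a n) _ _) _; rewrite normcBC; lra.
Qed.

End UltraLimit.

Lemma ultrafilter_nat : exists U : set_system nat, UltraFilter U /\ \oo `<=` U.
Proof. exact: (@ultraFilterLemma nat \oo _). Qed.

(** * Calculus of complex differentiable functions *)

Section CDiff.
Variable R : realType.
Implicit Types (f g : R[i] -> R[i]) (p : R[i]).

Lemma cdiff_comp f g p : cdiff g p -> cdiff f (g p) ->
  cdiff (fun z => f (g z)) p.
Proof.
exact: (@differentiable_comp _ R[i]^o R[i]^o R[i]^o g f p).
Qed.

Lemma cdiff_cst (c p : R[i]) : cdiff (fun=> c) p.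
Proof. exact: (@differentiable_cst _ R[i]^o R[i]^o c p). Qed.

Lemma cdiff_id p : cdiff (fun z => z) p.
Proof. exact: (@ex_diff _ _ _ _ _ _ _ (is_diff_id (p : R[i]^o))). Qed.

Lemma cdiffB f g p : cdiff f p -> cdiff g p -> cdiff (fun z => f z - g z) p.
Proof. exact: (@differentiableB _ R[i]^o R[i]^o f g p). Qed.

Lemma cdiffM f g p : cdiff f p -> cdiff g p -> cdiff (fun z => f z * g z) p.
Proof. exact: (@differentiableM _ R[i]^o f g p). Qed.

Lemma cdiffV f p : cdiff f p -> f p != 0 -> cdiff (fun z => (f z)^-1) p.
Proof. exact: (@differentiableV _ R[i]^o f p). Qed.

Lemma cdiffX f k p : cdiff f p -> cdiff (fun z => f z ^+ k) p.
Proof.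
move=> fd; elim: k => [|k IH]; first exact: cdiff_cst.
under eq_fun do rewrite exprS; exact: cdiffM.
Qed.

Lemma cdiff_cont f p : cdiff f p -> forall e : R, 0 < e ->
  exists2 d : R, 0 < d & forall x, N (x - p) < d -> N (f x - f p) < e.
Proof.
move=> fd e e0; have [d d0 h] := diff_cont_eps fd e0.
by exists d => // x hx; have := h x; rewrite !nrmC => /(_ hx).
Qed.

End CDiff.

(** * Goursat's theorem for trapezoid sums *)

Section Goursat.
Variable R : realType.
Local Notation C := R[i].
Implicit Types (f : C -> C) (a b c : C).

Definition mid a b : C := (a + b) / 2.

(** The trapezoid rule with 2^n equal steps for the integral of f from a to b.
    Defining it by halving makes it additive under bisection by computation. *)
Fixpoint edge_sum f (n : nat) a b : C :=
  if n is n'.+1 then edge_sum f n' a (mid a b) + edge_sum f n' (mid a b) b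
  else (f a + f b) / 2 * (b - a).

Definition tri_sum f n a b c : C :=
  edge_sum f n a b + edge_sum f n b c + edge_sum f n c a.

Definition perimeter a b c : R := N (b - a) + N (c - b) + N (a - c).

Definition midconvex (K : C -> Prop) := forall a b, K a -> K b -> K (mid a b).

Lemma normc_half a : N (a / 2) = N a / 2.
Proof. by rewrite normcM normcV normc_nat. Qed.

Lemma midC a b : mid a b = mid b a. Proof. by rewrite /mid addrC. Qed.

Lemma mid_subl a b : mid a b - a = (b - a) / 2.
Proof. by rewrite /mid; field. Qed.

Lemma mid_subr a b : b - mid a b = (b - a) / 2.
Proof. by rewrite /mid; field. Qed.

Lemma edge_sumC f n a b : edge_sum f n b a = - edge_sum f n a b.
Proof.
elim: n a b => [|n IH] a b /=; first by ring.
by rewrite (midC b a) IH (IH a) opprD addrC.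
Qed.

(** The trapezoid rule integrates affine functions exactly, so only the
    deviation of f from an affine function contributes to the difference. *)
Lemma edge_sum_affine_approx f (K : C -> Prop) (al be : C) (M : R) n a b :
  midconvex K -> K a -> K b ->
  (forall z, K z -> N (f z - (al + be * z)) <= M) ->
  N (edge_sum f n a b - (al * (b - a) + be * (b ^+ 2 - a ^+ 2) / 2))
    <= M * N (b - a).
Proof.
move=> Kc + + H; elim: n a b => [|n IH] a b Ka Kb /=.
  have -> : (f a + f b) / 2 * (b - a) -
     (al * (b - a) + be * (b ^+ 2 - a ^+ 2) / 2) =
     ((f a - (al + be * a)) + (f b - (al + be * b))) / 2 * (b - a) by field.
  rewrite normcM normc_half; apply: ler_wpM2r; first exact: normc_ge0.
  have := le_normcD (f a - (al + be * a)) (f b - (al + be * b)).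
  have := H _ Ka; have := H _ Kb; lra.
have Km := Kc _ _ Ka Kb.
have h1 := IH _ _ Ka Km; have h2 := IH _ _ Km Kb.
rewrite mid_subl normc_half in h1; rewrite mid_subr normc_half in h2.
have -> : edge_sum f n a (mid a b) + edge_sum f n (mid a b) b -
  (al * (b - a) + be * (b ^+ 2 - a ^+ 2) / 2) =
 (edge_sum f n a (mid a b) -
     (al * ((b - a) / 2) + be * (mid a b ^+ 2 - a ^+ 2) / 2)) +
 (edge_sum f n (mid a b) b -
     (al * ((b - a) / 2) + be * (b ^+ 2 - mid a b ^+ 2) / 2)) by field.
by apply: le_trans (le_normcD _ _) _; lra.
Qed.

(** The increments of the primitive of an affine function cancel around a
    closed path. *)
Lemma tri_sum_affine_approx f (K : C -> Prop) (al be : C) (M : R) n a b c :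
  midconvex K -> K a -> K b -> K c ->
  (forall z, K z -> N (f z - (al + be * z)) <= M) ->
  N (tri_sum f n a b c) <= M * perimeter a b c.
Proof.
move=> Kc Ka Kb Kcc H.
have h1 := edge_sum_affine_approx n Kc Ka Kb H.
have h2 := edge_sum_affine_approx n Kc Kb Kcc H.
have h3 := edge_sum_affine_approx n Kc Kcc Ka H.
have -> : tri_sum f n a b c =
  (edge_sum f n a b - (al * (b - a) + be * (b ^+ 2 - a ^+ 2) / 2)) +
  (edge_sum f n b c - (al * (c - b) + be * (c ^+ 2 - b ^+ 2) / 2)) +
  (edge_sum f n c a - (al * (a - c) + be * (a ^+ 2 - c ^+ 2) / 2)).
  by rewrite /tri_sum; field.
rewrite /perimeter; apply: le_trans (le_normcD _ _) _.
by apply: le_trans (lerD (le_normcD _ _) h3) _; lra.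
Qed.

(** The sides of the middle triangle are traversed twice, in opposite
    directions. *)
Lemma tri_sumS f n a b c :
  tri_sum f n.+1 a b c =
  tri_sum f n a (mid a b) (mid c a) + tri_sum f n (mid a b) b (mid b c) +
  tri_sum f n (mid c a) (mid b c) c + tri_sum f n (mid a b) (mid b c) (mid c a).
Proof.
rewrite /tri_sum /= (edge_sumC f n (mid c a) (mid a b)).
rewrite (edge_sumC f n (mid a b) (mid b c)) (edge_sumC f n (mid b c) (mid c a)).
by ring.
Qed.

(** A triangle whose sums exceed e L^2 (with L the perimeter) for arbitrarily
    fine subdivisions. This is an estimate that one of the four half-sized
    triangles inherits. *)
Definition bad f (e : R) (t : C * C * C) :=
  forall n0, exists2 n, (n0 <= n)%N &
    e * perimeter t.1.1 t.1.2 t.2 ^+ 2 < N (tri_sum f n t.1.1 t.1.2 t.2).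

Lemma not_bad f e a b c : ~ bad f e (a, b, c) ->
  exists n0, forall n, (n0 <= n)%N ->
     N (tri_sum f n a b c) <= e * perimeter a b c ^+ 2.
Proof.
move=> /existsNP [n0 h]; exists n0 => n nn; rewrite leNgt; apply/negP => l.
by apply: h; exists n.
Qed.

Definition tri_in (K : C -> Prop) (t : C * C * C) :=
  [/\ K t.1.1, K t.1.2 & K t.2].

Lemma bad_step f (K : C -> Prop) e t : midconvex K ->
  tri_in K t -> bad f e t ->
  exists t', [/\ tri_in K t', bad f e t',
    perimeter t'.1.1 t'.1.2 t'.2 = perimeter t.1.1 t.1.2 t.2 / 2 &
    N (t'.1.1 - t.1.1) <= perimeter t.1.1 t.1.2 t.2].
Proof.
case: t => [[a b] c] Kc [/= Ka Kb Kcc] B.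
have Kab := Kc _ _ Ka Kb; have Kbc := Kc _ _ Kb Kcc; have Kca := Kc _ _ Kcc Ka.
have P1 : perimeter a (mid a b) (mid c a) = perimeter a b c / 2.
  rewrite /perimeter mid_subl normc_half.
  have -> : mid c a - mid a b = (c - b) / 2 by rewrite /mid; field.
  have -> : a - mid c a = (a - c) / 2 by rewrite /mid; field.
  rewrite !normc_half; lra.
have P2 : perimeter (mid a b) b (mid b c) = perimeter a b c / 2.
  rewrite /perimeter mid_subl mid_subr.
  have -> : mid a b - mid b c = (a - c) / 2 by rewrite /mid; field.
  rewrite !normc_half; lra.
have P3 : perimeter (mid c a) (mid b c) c = perimeter a b c / 2.
  rewrite /perimeter mid_subr mid_subl.
  have -> : mid b c - mid c a = (b - a) / 2 by rewrite /mid; field.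
  rewrite !normc_half; lra.
have P4 : perimeter (mid a b) (mid b c) (mid c a) = perimeter a b c / 2.
  rewrite /perimeter.
  have -> : mid b c - mid a b = (c - a) / 2 by rewrite /mid; field.
  have -> : mid c a - mid b c = (a - b) / 2 by rewrite /mid; field.
  have -> : mid a b - mid c a = (b - c) / 2 by rewrite /mid; field.
  rewrite !normc_half (normcBC a b) (normcBC b c) (normcBC a c); lra.
have pa := normc_ge0 (b - a); have pb := normc_ge0 (c - b).
have pc := normc_ge0 (a - c).
have D1 : N (mid a b - a) <= perimeter a b c.
  by rewrite mid_subl normc_half /perimeter; lra.
have D2 : N (mid c a - a) <= perimeter a b c.
  by rewrite midC mid_subl normc_half normcBC /perimeter; lra.
have D0 : N (a - a) <= perimeter a b c by rewrite subrr normc0 /perimeter; lra.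
have [B1|/not_bad [n1 h1]] := pselect (bad f e (a, mid a b, mid c a)).
  by exists (a, mid a b, mid c a).
have [B2|/not_bad [n2 h2]] := pselect (bad f e (mid a b, b, mid b c)).
  by exists (mid a b, b, mid b c).
have [B3|/not_bad [n3 h3]] := pselect (bad f e (mid c a, mid b c, c)).
  by exists (mid c a, mid b c, c).
have [B4|/not_bad [n4 h4]] := pselect (bad f e (mid a b, mid b c, mid c a)).
  by exists (mid a b, mid b c, mid c a).
exfalso; have [/= [//|n]] := B (maxn n1 (maxn n2 (maxn n3 n4))).+1.
rewrite ltnS !geq_max => /and4P[l1 l2 l3 l4].
rewrite ltNge => /negP; apply.
rewrite tri_sumS.
have := h1 _ l1; have := h2 _ l2; have := h3 _ l3; have := h4 _ l4.
rewrite P1 P2 P3 P4 expr_div_n.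
move: (tri_sum _ _ _ _ _) => w; move: (tri_sum _ _ _ _ _) => x.
move: (tri_sum _ _ _ _ _) => y; move: (tri_sum _ _ _ _ _) => z.
have := le_normcD (y + x + z) w; have := le_normcD (y + x) z; have := le_normcD y x.
have := le_normcD (z + y + x) w; have := le_normcD (z + y) x; have := le_normcD z y.
move=> *; lra.
Qed.

(** Bisection: bad triangles would shrink to a point p of K, where f differs
    from an affine function by little compared with the distance to p, so the
    sums are small compared with the square of the perimeter. *)
Lemma goursat f (K : C -> Prop) a b c : midconvex K ->
  (forall p, (forall e, 0 < e -> exists2 q, K q & N (q - p) < e) -> K p) ->
  (forall p, K p -> cdiff f p) ->
  K a -> K b -> K c ->
  forall e, 0 < e -> exists n0, forall n, (n0 <= n)%N ->
    N (tri_sum f n a b c) <= e.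
Proof.
move=> Kc Kcl fd Ka Kb Kcc e e0.
set L := perimeter a b c.
have L0 : 0 <= L by rewrite /L /perimeter !addr_ge0 ?normc_ge0.
have d0 : 0 < L ^+ 2 + 1 by rewrite ltr_wpDl ?exprn_ge0.
(* L may be 0, hence the + 1. *)
pose e' := e / (L ^+ 2 + 1).
have e'0 : 0 < e' by rewrite divr_gt0.
suff nb : ~ bad f e' (a, b, c).
  have [n0 h] := not_bad nb; exists n0 => n /h /le_trans; apply.
  by rewrite /e' -/L mulrAC ler_pdivrMr // mulrDr mulr1 lerDl ltW.
move=> B0.
have /choice [s hs] : forall t, exists t', tri_in K t /\ bad f e' t ->
    [/\ tri_in K t', bad f e' t',
    perimeter t'.1.1 t'.1.2 t'.2 = perimeter t.1.1 t.1.2 t.2 / 2 &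
    N (t'.1.1 - t.1.1) <= perimeter t.1.1 t.1.2 t.2].
  move=> t; have [[h1 h2]|h] := pselect (tri_in K t /\ bad f e' t).
    by have [t' ht'] := bad_step Kc h1 h2; exists t'.
  by exists t => /h.
pose t n := iter n s (a, b, c).
have tP n : tri_in K (t n) /\ bad f e' (t n).
  by elim: n => [//|n IH]; have [? ? _ _] := hs _ IH.
pose l n := perimeter (t n).1.1 (t n).1.2 (t n).2.
have lE n : l n = L / 2 ^+ n.
  elim: n => [|n IH]; first by rewrite expr0 divr1.
  by have [_ _ h _] := hs _ (tP n); rewrite {1}/l /= h -/(l n) IH exprSr invfM mulrA.
pose v n := (t n).1.1.
have vS n : N (v n.+1 - v n) <= l n by have [_ _ _] := hs _ (tP n).
have l0 n : 0 <= l n by rewrite lE divr_ge0 // exprn_ge0.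
have lS n : l n.+1 = l n / 2 by rewrite !lE exprSr invfM mulrA.
have vk n k : N (v (n + k)%N - v n) <= 2 * l n - 2 * l (n + k)%N.
  elim: k => [|k IH]; first by rewrite addn0 !subrr normc0.
  apply: le_trans (normc_triangle (v (n + k)%N) _ _) _.
  by have := vS (n + k)%N; rewrite addnS lS; lra.
have vM n : N (v n) <= N (v 0%N) + 2 * l 0%N.
  have := vk 0%N n; rewrite add0n => h.
  rewrite -[v n](subrK (v 0%N)); apply: le_trans (le_normcD _ _) _.
  by have := l0 n; lra.
have [U [UU Uo]] := ultrafilter_nat.
have [p hp] := ultra_limit (U := U) vM.
have vp n : N (p - v n) <= 2 * l n.
  apply: ultra_limit_le hp _; apply: Uo; exists n => // m /= nm.
  by have := vk n (m - n)%N; rewrite subnKC // => h; have := l0 m; lra.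
have lsmall (d : R) : 0 < d -> exists n, l n < d.
  move=> dd; have [n hn] : exists n : nat, L / d < 2 ^+ n.
    exists (Num.truncn (L / d)).+1.
    apply: lt_trans (truncnS_gt _) _.
    by rewrite -natrX ltr_nat ltn_expl.
  by exists n; rewrite lE ltr_pdivrMr ?exprn_gt0 // mulrC -ltr_pdivrMr.
have Kp : K p.
  apply: Kcl => d dd; have [n hn] : exists n, l n < d / 4 by apply: lsmall; lra.
  exists (v n); first by have [[]] := tP n.
  by rewrite normcBC; have := vp n; lra.
have [lam hlam] := cdiff_eps (fd _ Kp).
have [d dd hd] : exists2 d : R, 0 < d & forall z : R[i], N (z - p) < d ->
     N (f z - f p - lam * (z - p)) <= e' / 4 * N (z - p) by apply: hlam; lra.
have [n hn] : exists n, l n < d / 8 by apply: lsmall; lra.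
have [[K1 K2 K3] B] := tP n.
have [m _] := B 0%N; rewrite ltNge => /negP; apply.
(* A disc about p containing the whole n-th triangle, whose vertices are
   within 3 l n of p. *)
pose K' z := N (z - p) <= 4 * l n.
have Kc' : midconvex K'.
  move=> x y; rewrite /K' => hx hy.
  have -> : mid x y - p = ((x - p) + (y - p)) / 2 by rewrite /mid; field.
  by rewrite normc_half; have := le_normcD (x - p) (y - p); lra.
have [pa pb pc] : [/\ 0 <= N ((t n).1.2 - (t n).1.1),
   0 <= N ((t n).2 - (t n).1.2) & 0 <= N ((t n).1.1 - (t n).2)].
  by split; exact: normc_ge0.
have lnE : l n = N ((t n).1.2 - (t n).1.1) + N ((t n).2 - (t n).1.2)
     + N ((t n).1.1 - (t n).2) by [].
have vp' : N ((t n).1.1 - p) <= 2 * l n by rewrite normcBC; exact: vp.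
have K1' : K' (t n).1.1 by rewrite /K'; have := l0 n; lra.
have K2' : K' (t n).1.2.
  rewrite /K'; apply: le_trans (normc_triangle (t n).1.1 _ _) _; lra.
have K3' : K' (t n).2.
  rewrite /K'; apply: le_trans (normc_triangle (t n).1.1 _ _) _.
  rewrite (normcBC (t n).2); lra.
have -> : e' * perimeter (t n).1.1 (t n).1.2 (t n).2 ^+ 2 = e' / 4 * (4 * l n) * l n.
  by rewrite -/(l n); field.
apply: (tri_sum_affine_approx (K := K') (al := f p - lam * p) (be := lam)) => //.
move=> z hz; have -> : f z - (f p - lam * p + lam * z) =
   f z - f p - lam * (z - p) by ring.
have zd : N (z - p) < d by move: hz; rewrite /K'; lra.
apply: le_trans (hd _ zd) _; apply: ler_wpM2l => //; lra.
Qed.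

End Goursat.

(** * The complex exponential and the value at the centre of the disc *)

Section Exp.
Variable R : realType.
Local Notation C := R[i].

Lemma is_derive_eps (g : R -> R) (x dg : R) : is_derive x 1 g dg ->
  forall e : R, 0 < e -> exists2 d : R, 0 < d &
    forall h, `|h| < d -> `|g (x + h) - g x - h * dg| <= e * `|h|.
Proof.
move=> [gd <-] e e0.
have /eqaddoP /(_ _ e0) := derivable_nbhs gd.
move=> /nbhs_norm0P [d d0 hd]; exists d => // h hh.
by move: (hd h hh); rewrite /= !fctE /= [h *: 1]mulr1 [h + x]addrC opprD addrA.
Qed.

Definition cexp (w : C) : C :=
  ((expR (Re w) * cos (Im w)) +i* (expR (Re w) * sin (Im w)))%C.

Lemma cexpD w h : cexp (w + h) = cexp w * cexp h.
Proof.
case: w => a b; case: h => x y; rewrite /cexp /= expRD cosD sinD.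
apply/eqP; rewrite eq_complex /=; apply/andP; split; apply/eqP; ring.
Qed.

Lemma normc_cexp w : N (cexp w) = expR (Re w).
Proof.
rewrite /cexp /= !exprMn -mulrDr cos2Dsin2 mulr1 sqrtr_sqr ger0_norm // expR_ge0.
Qed.

(** In real coordinates the error is (e^x - 1 - x) + e^x (cos y - 1) for the
    real part and e^x (sin y - y) + (e^x - 1) y for the imaginary part. *)
Lemma cexp_near0 (e : R) : 0 < e ->
  exists2 d : R, 0 < d & forall h, N h < d -> N (cexp h - 1 - h) <= e * N h.
Proof.
(* Six error terms of size e1 |h| occur below; e1 <= 1 bounds e^x by 2. *)
move=> e0; pose e1 := Num.min (e / 8) 1.
have e10 : 0 < e1 by rewrite lt_min divr_gt0 /=.
have e11 : e1 <= 1 by rewrite ge_min lexx orbT.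
have e1e : e1 <= e / 8 by rewrite ge_min lexx.
have [d1 d10 h1] := is_derive_eps (is_derive_expR 0) e10.
have [d2 d20 h2] := is_derive_eps (is_derive_cos (0 : R)) e10.
have [d3 d30 h3] := is_derive_eps (is_derive_sin (0 : R)) e10.
pose d := Num.min (Num.min d1 d2) (Num.min d3 (e1 / 2)).
have dd : 0 < d by rewrite !lt_min d10 d20 d30 /= divr_gt0.
exists d => // h; rewrite !lt_min => /andP[/andP[l1 l2] /andP[l3 l4]].
have xh := Re_le_normc h; have yh := Im_le_normc h.
case: h => x y in l1 l2 l3 l4 xh yh *.
set n : R := N _ in l1 l2 l3 l4 xh yh *.
change (is_true (`|x| <= n)) in xh; change (is_true (`|y| <= n)) in yh.
have {}h1 := h1 x (le_lt_trans xh l1).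
have {}h2 := h2 y (le_lt_trans yh l2).
have {}h3 := h3 y (le_lt_trans yh l3).
rewrite add0r expR0 mulr1 in h1.
rewrite add0r cos0 sin0 oppr0 mulr0 subr0 in h2.
rewrite add0r sin0 cos0 subr0 mulr1 in h3.
have n0 : 0 <= n by apply: le_trans xh.
have en : e1 * n <= n by exact: ler_piMl.
have e1x : e1 * `|x| <= e1 * n by apply: ler_wpM2l => //; exact: ltW.
have e1y : e1 * `|y| <= e1 * n by apply: ler_wpM2l => //; exact: ltW.
have exm : `|expR x - 1| <= 2 * n.
  rewrite -[expR x - 1](subrK x); apply: le_trans (ler_normD _ _) _; lra.
have ex2 : `|expR x| <= 2.
  rewrite -[expR x](subrK 1); apply: le_trans (ler_normD _ _) _.
  rewrite normr1; lra.
have t1 : `|expR x * (cos y - 1)| <= 2 * (e1 * n).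
  by rewrite normrM ler_pM // (le_trans h2).
have t2 : `|expR x * (sin y - y)| <= 2 * (e1 * n).
  by rewrite normrM ler_pM // (le_trans h3).
have t3 : `|(expR x - 1) * y| <= e1 * n.
  rewrite normrM; apply: ler_pM => //; lra.
have a1 : `|Re (cexp (x +i* y)%C - 1 - (x +i* y)%C)| <= 3 * (e1 * n).
  have -> : Re (cexp (x +i* y)%C - 1 - (x +i* y)%C) =
     (expR x - 1 - x) + expR x * (cos y - 1).
    by rewrite /=; ring.
  by apply: le_trans (ler_normD _ _) _; lra.
have a2 : `|Im (cexp (x +i* y)%C - 1 - (x +i* y)%C)| <= 3 * (e1 * n).
  have -> : Im (cexp (x +i* y)%C - 1 - (x +i* y)%C) =
     expR x * (sin y - y) + (expR x - 1) * y.
    by rewrite /=; ring.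
  by apply: le_trans (ler_normD _ _) _; lra.
apply: le_trans (normc_le_ReIm _) _.
have : e1 * n <= e / 8 * n by apply: ler_wpM2r.
have : 0 <= e * n by rewrite mulr_ge0 // ltW.
lra.
Qed.

Lemma cdiff_cexp w : cdiff cexp w.
Proof.
apply: (@cdiff_from_eps _ _ _ (cexp w)) => e e0.
have ew : 0 < expR (Re w) by exact: expR_gt0.
have [d d0 hd] := cexp_near0 (divr_gt0 e0 ew).
exists d => // z /hd h.
have -> : cexp z - cexp w - cexp w * (z - w) =
    cexp w * (cexp (z - w) - 1 - (z - w)).
  by rewrite !mulrBr -cexpD mulr1 addrC [w + _]addrC subrK; ring.
rewrite normcM normc_cexp; apply: le_trans (ler_wpM2l (ltW ew) h) _.
by rewrite mulrA [e / _]mulrC mulrA mulfV ?gt_eqF // mul1r.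
Qed.

Definition period : C := (0 +i* (pi *+ 2))%C.

Lemma cexp_period w : cexp (w + period) = cexp w.
Proof.
by case: w => x y; rewrite /cexp /= addr0 cosD2pi sinD2pi.
Qed.

Lemma normc_period : N period = pi *+ 2.
Proof.
have p0 : 0 <= pi *+ 2 :> R by rewrite mulrn_wge0 // pi_ge0.
by rewrite /= expr0n add0r sqrtr_sqr ger0_norm.
Qed.

Lemma Re_mid (a b : C) : Re (mid a b) = (Re a + Re b) / 2.
Proof.
rewrite /mid -[2 : C](rmorph_nat (real_complex R)) -fmorphV.
by case: a => x y; case: b => u v /=; rewrite mulr0 subr0.
Qed.

Lemma edge_sum_period (F : C -> C) n a b :
  (forall w, F (w + period) = F w) ->
  edge_sum F n (a + period) (b + period) = edge_sum F n a b.
Proof.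
move=> hF; elim: n a b => [|n IH] a b /=.
  by rewrite !hF; congr (_ * _); ring.
have -> : mid (a + period) (b + period) = mid a b + period.
  by rewrite /mid; field.
by rewrite !IH.
Qed.

(** Put F = f o cexp, which has the period 2 pi i. On the rectangle with sides
    at Re w = s0 and Re w = s1 the sums over the horizontal sides cancel by
    periodicity, so those over the two vertical sides agree in the limit. For
    s1 close to minus infinity the left one is close to 2 pi i f(0), while the
    right one is at most 2 pi M. *)
Lemma mean_bound (f : C -> C) (M r : R) : r < 1 ->
  (forall z, N z < 1 -> cdiff f z) ->
  (forall z, r < N z -> N z < 1 -> N (f z) <= M) ->
  N (f 0) <= M.
Proof.
move=> r1 fd fM; apply/ler_addgt0Pr => e e0.
have f0d : cdiff f 0 by apply: fd; rewrite normc0.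
have e2 : 0 < e / 2 by lra.
have [d d0 hd] := cdiff_cont f0d e2.
(* Radii: rho lies in the collar where f is bounded by M, rho' in the
   neighbourhood of 0 where f is close to f 0. *)
pose rho := (Num.max r 0 + 1) / 2.
have m1 : Num.max r 0 < 1 by rewrite gt_max r1 ltr01.
have m0 : 0 <= Num.max r 0 by rewrite le_max lexx orbT.
have rm : r <= Num.max r 0 by rewrite le_max lexx.
have [rho0 rho1 rrho] : [/\ 0 < rho, rho < 1 & r < rho] by rewrite /rho; split; lra.
pose rho' := Num.min rho (d / 2).
have rho'0 : 0 < rho' by rewrite lt_min rho0 divr_gt0.
have rho'r : rho' <= rho by rewrite ge_min lexx.
have rho'd : rho' < d by rewrite gt_min; apply/orP; right; lra.
pose s0 := ln rho; pose s1 := ln rho'.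
have E0 : expR s0 = rho by rewrite lnK.
have E1 : expR s1 = rho' by rewrite lnK.
pose a0 : C := s0%:C%C; pose a1 : C := s1%:C%C.
pose F w := f (cexp w).
have FP w : F (w + period) = F w by rewrite /F cexp_period.
pose K (w : C) := Re w <= s0.
have Kmid : midconvex K by move=> a b; rewrite /K Re_mid; lra.
have Kcl p : (forall e, 0 < e -> exists2 q, K q & N (q - p) < e) -> K p.
  move=> H; rewrite /K; apply/ler_addgt0Pr => u /H [q Kq hq].
  have := le_lt_trans (Re_le_normc _) hq; rewrite raddfB /= ltr_norml => /andP[h1 h2].
  by move: Kq; rewrite /K; lra.
have Fd p : K p -> cdiff F p.
  move=> Kp; apply: cdiff_comp; first exact: cdiff_cexp.
  apply: fd; rewrite normc_cexp; apply: le_lt_trans rho1.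
  by rewrite -E0 ler_expR.
have s10 : s1 <= s0 by rewrite /s1 /s0 ler_ln.
have Ka0 : K a0 by rewrite /K.
have Ka1 : K a1 by rewrite /K.
have Ka0' : K (a0 + period) by rewrite /K raddfD /= addr0.
have Ka1' : K (a1 + period) by rewrite /K raddfD /= addr0.
have pi0 : 0 < pi *+ 2 :> R by rewrite pmulrn_rgt0 // pi_gt0.
have e3 : 0 < e / 4 * (pi *+ 2) by rewrite mulr_gt0 //; lra.
(* The diagonal from a0 to a1 + period cuts the rectangle into two triangles. *)
have [n1 h1] := goursat Kmid Kcl Fd Ka0 Ka0' Ka1' e3.
have [n2 h2] := goursat Kmid Kcl Fd Ka0 Ka1' Ka1 e3.
have {}h1 := h1 _ (leq_maxl n1 n2); have {}h2 := h2 _ (leq_maxr n1 n2).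
set n := maxn n1 n2 in h1 h2.
have Vmid s : midconvex (fun w : C => Re w = s).
  by move=> a b; rewrite Re_mid => -> ->; lra.
have b0 : N (edge_sum F n a0 (a0 + period)) <= M * (pi *+ 2).
  have -> : edge_sum F n a0 (a0 + period) = edge_sum F n a0 (a0 + period) -
      (0 * (a0 + period - a0) + 0 * ((a0 + period) ^+ 2 - a0 ^+ 2) / 2) by ring.
  rewrite -normc_period -[period in leRHS](addKr a0) [- a0 + _]addrC.
  apply: (edge_sum_affine_approx (K := fun w => Re w = s0)) => //.
  - by rewrite raddfD /= addr0.
  - move=> z zs; rewrite mul0r addr0 subr0; apply: fM.
      by rewrite normc_cexp zs E0.
    by rewrite normc_cexp zs E0.
have b1 : N (edge_sum F n a1 (a1 + period) - f 0 * period) <= e / 2 * (pi *+ 2).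
  have -> : edge_sum F n a1 (a1 + period) - f 0 * period =
      edge_sum F n a1 (a1 + period) - (f 0 * (a1 + period - a1)
       + 0 * ((a1 + period) ^+ 2 - a1 ^+ 2) / 2) by ring.
  rewrite -normc_period -[period in leRHS](addKr a1) [- a1 + _]addrC.
  apply: (edge_sum_affine_approx (K := fun w => Re w = s1)) => //.
  - by rewrite raddfD /= addr0.
  - move=> z zs; rewrite mul0r addr0.
    have := hd (cexp z); rewrite subr0 normc_cexp zs E1 => /(_ rho'd).
    exact: ltW.
rewrite -(ler_pM2r pi0) -normc_period -normcM.
have -> : f 0 * period = - (edge_sum F n a1 (a1 + period) - f 0 * period)
   - (tri_sum F n a0 (a0 + period) (a1 + period)
     + tri_sum F n a0 (a1 + period) a1)
   + edge_sum F n a0 (a0 + period).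
  rewrite /tri_sum (edge_sumC F n a1 (a1 + period)).
  rewrite (edge_sum_period n a0 a1 FP) (edge_sumC F n a0 a1).
  rewrite (edge_sumC F n a0 (a1 + period)); ring.
apply: le_trans (le_normcD _ _) _; apply: le_trans (lerD (le_normcB _ _) b0) _.
rewrite normcN normc_period.
apply: (@le_trans _ _ (e / 2 * (pi *+ 2) + (e / 4 * (pi *+ 2) + e / 4 * (pi *+ 2))
   + M * (pi *+ 2))); last by lra.
apply: lerD => //; apply: lerD => //; apply: le_trans (le_normcD _ _) _; exact: lerD.
Qed.

End Exp.

(** * Automorphisms of the disc *)

Section Mobius.
Variable R : realType.
Local Notation C := R[i].
Implicit Types (f g : C -> C) (p q z w : C).

(** The automorphism of the disc sending p to 0; its inverse is the one of -
    p. *)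
Definition mobius p z : C := (z - p) / (1 - p^* * z).

(** The identity behind every comparison of mobius p z with 1: the left-hand
    side has the sign of 1 - |z|^2 when |p| < 1. *)
Lemma mobius_sqr_identity p z :
  N (1 - p^* * z) ^+ 2 - N (z - p) ^+ 2 = (1 - N p ^+ 2) * (1 - N z ^+ 2).
Proof.
rewrite !sqr_normcE; case: p => a b; case: z => x y; rewrite conj_conjc /=; ring.
Qed.

Lemma mobius_den_neq0 p z : N p < 1 -> N z <= 1 -> 1 - p^* * z != 0.
Proof.
move=> p1 z1; rewrite subr_eq0; apply/eqP => h.
have : N (p^* * z) = 1 by rewrite -h normc1.
rewrite normcM normc_conj => e; have := ler_piMr (normc_ge0 p) z1; lra.
Qed.

Lemma one_sub_mobius_sqr p z : N p < 1 -> N z <= 1 ->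
  1 - N (mobius p z) ^+ 2 = (1 - N p ^+ 2) * (1 - N z ^+ 2) / N (1 - p^* * z) ^+ 2.
Proof.
move=> p1 z1; have d := mobius_den_neq0 p1 z1.
rewrite -mobius_sqr_identity /mobius normcM normcV exprMn exprVn mulrBl divff //.
by rewrite expf_neq0 // normc_eq0.
Qed.

Lemma sqr_lt1 (x : R) : 0 <= x -> (x ^+ 2 < 1) = (x < 1).
Proof. by move=> x0; rewrite expr_lt1. Qed.

Lemma mobius_lt1 p z : N p < 1 -> N z < 1 -> N (mobius p z) < 1.
Proof.
move=> p1 z1; rewrite -sqr_lt1 ?normc_ge0 // -subr_gt0 one_sub_mobius_sqr // ?ltW //.
apply: divr_gt0; first by apply: mulr_gt0; rewrite subr_gt0 sqr_lt1 ?normc_ge0.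
by rewrite exprn_gt0 // normc_gt0 mobius_den_neq0 // ltW.
Qed.

Lemma mobius_le1 p z : N p < 1 -> N z <= 1 -> N (mobius p z) <= 1.
Proof.
move=> p1 z1; rewrite -(@expr_le1 _ 2) ?normc_ge0 // -subr_ge0 one_sub_mobius_sqr //.
apply: divr_ge0; last exact: sqr_ge0.
by apply: mulr_ge0; rewrite subr_ge0 expr_le1 ?normc_ge0 // ltW.
Qed.

Lemma mobiusK p z : N p < 1 -> N z <= 1 -> mobius (- p) (mobius p z) = z.
Proof.
move=> p1 z1; have d := mobius_den_neq0 p1 z1; have e := mobius_den_neq0 p1 (ltW p1).
rewrite {1}/mobius rmorphN.
have -> : mobius p z - - p = z * (1 - p^* * p) / (1 - p^* * z).
  by rewrite /mobius; field.
have -> : 1 - - p^* * mobius p z = (1 - p^* * p) / (1 - p^* * z).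
  by rewrite /mobius; field.
by field; rewrite d e.
Qed.

Lemma mobiusxx p : mobius p p = 0.
Proof. by rewrite /mobius subrr mul0r. Qed.

Lemma mobius_eq0 p z : N p < 1 -> N z <= 1 -> (mobius p z == 0) = (z == p).
Proof.
move=> p1 z1; rewrite /mobius mulf_eq0 invr_eq0 subr_eq0.
by rewrite (negPf (mobius_den_neq0 p1 z1)) orbF.
Qed.

Lemma cdiff_mobius p z : N p < 1 -> N z <= 1 -> cdiff (mobius p) z.
Proof.
move=> p1 z1; apply: cdiffM; first by apply: cdiffB; [exact: cdiff_id|exact: cdiff_cst].
apply: cdiffV; last exact: mobius_den_neq0.
apply: cdiffB; first exact: cdiff_cst.
by apply: cdiffM; [exact: cdiff_cst|exact: cdiff_id].
Qed.

(** On the disc 1 - |mobius p z|^2 is at most (1 - |z|^2) / (1 - |p|)^2, so it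
    is small as soon as 1 - |z| is. *)
Lemma mobius_boundary p (r : R) : N p < 1 -> r < 1 ->
  exists2 r' : R, r' < 1 &
    forall z, r' < N z -> N z < 1 -> r < N (mobius p z).
Proof.
move=> p1 r1; pose rho := Num.max r 0.
have m1 : rho < 1 by rewrite gt_max r1 ltr01.
have m0 : 0 <= rho by rewrite le_max lexx orbT.
have rm : r <= rho by rewrite le_max lexx.
have p0 := normc_ge0 p.
have k0 : 0 < 1 - rho ^+ 2 by rewrite subr_gt0 sqr_lt1.
have k1 : 0 < (1 - N p) ^+ 2 by rewrite exprn_gt0 // subr_gt0.
pose eta := (1 - rho ^+ 2) * (1 - N p) ^+ 2 / 2.
have eta0 : 0 < eta by apply: divr_gt0 => //; exact: mulr_gt0.
exists (1 - eta) => [|z z0 z1]; first by lra.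
apply: (le_lt_trans rm).
rewrite -(@ltr_pXn2r _ 2) ?nnegrE ?normc_ge0 //.
suff : 1 - N (mobius p z) ^+ 2 < 1 - rho ^+ 2 by lra.
have d := mobius_den_neq0 p1 (ltW z1).
have D0 : 0 < N (1 - p^* * z) ^+ 2 by rewrite exprn_gt0 // normc_gt0.
rewrite one_sub_mobius_sqr // ?ltW // ltr_pdivrMr //.
have Nz0 := normc_ge0 z.
have h1 : (1 - N p) ^+ 2 <= N (1 - p^* * z) ^+ 2.
  apply: lerXn2r; rewrite ?nnegrE ?normc_ge0 //; first by lra.
  have := lerB_normcB 1 (p^* * z); rewrite normc1 normcM normc_conj.
  have := ler_piMr p0 (ltW z1); lra.
have h2 : 1 - N z ^+ 2 < 2 * eta by nra.
have h3 : (1 - N p ^+ 2) * (1 - N z ^+ 2) <= 1 - N z ^+ 2.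
  apply: ler_piMl; last by have := sqr_ge0 (N p); lra.
  by rewrite subr_ge0 expr_le1 // ltW.
apply: le_lt_trans h3 _; apply: lt_le_trans h2 _.
have -> : 2 * eta = (1 - rho ^+ 2) * (1 - N p) ^+ 2 by rewrite /eta; field.
by apply: ler_wpM2l => //; exact: ltW.
Qed.

(** * The maximum principle on the disc *)

(** The upper limit of |f| at the unit circle is at most M; no values on the
    circle itself are involved. *)
Definition boundary_le f (M : R) := forall e, 0 < e -> exists2 r : R, r < 1 &
  forall z, r < N z -> N z < 1 -> N (f z) <= M + e.

Lemma maximum_principle f (M : R) : (forall z, N z < 1 -> cdiff f z) ->
  boundary_le f M -> forall p, N p < 1 -> N (f p) <= M.
Proof.
move=> fd fb p p1; apply/ler_addgt0Pr => e /fb [r r1 hr].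
have p1' : N (- p) < 1 by rewrite normcN.
have [r' r'1 hr'] := mobius_boundary p1' r1.
have -> : p = mobius (- p) 0 by rewrite /mobius mulr0 subr0 divr1 sub0r opprK.
apply: (@mean_bound _ (fun z => f (mobius (- p) z)) _ r') => //.
  move=> z z1; apply: cdiff_comp; first by apply: cdiff_mobius => //; exact: ltW.
  by apply: fd; exact: mobius_lt1.
by move=> z z0 z1; apply: hr; [exact: hr'|exact: mobius_lt1].
Qed.

Definition ccont f p := forall e : R, 0 < e ->
  exists2 d : R, 0 < d & forall z, N (z - p) < d -> N (f z - f p) < e.

Lemma ccontP f p : ccont f p <-> {for p, continuous (f : R[i]^o -> R[i]^o)}.
Proof.
split=> [H|/cvgrPdistC_lt H e e0].
  apply: (proj2 (@cvgrPdistC_lt _ R[i]^o _ (nbhs (p : R[i]^o)) _ f (f p))).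
  move=> _ /real_posP [e e0 ->].
  have [d d0 hd] := H _ e0.
  apply: (proj2 (@near_nrm _ R[i]^o p _)); exists d => // x.
  by rewrite nrmE !nrmC ltcR; exact: hd.
have e0' : 0 < e%:C%C by rewrite ltcR.
have /near_nrm[d d0 hd] := H _ e0'; exists d => // x xd.
by have := hd x; rewrite nrmC nrmE ltcR nrmC; exact.
Qed.

Lemma cdiff_ccont f p : cdiff f p -> ccont f p.
Proof. by move=> fd e e0; exact: cdiff_cont. Qed.

Lemma ccontM f g p : ccont f p -> ccont g p -> ccont (fun z => f z * g z) p.
Proof. by move=> /ccontP h1 /ccontP h2; apply/ccontP; exact: (continuousM h1 h2). Qed.

Lemma ccontX f n p : ccont f p -> ccont (fun z => f z ^+ n) p.
Proof.
move=> h; elim: n => [|n IH]; first by apply: cdiff_ccont; exact: cdiff_cst.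
under eq_fun do rewrite exprS; exact: ccontM.
Qed.

(** The difference quotient of (z - p) f(z) at p is f(z). *)
Lemma cdiff_mul_sub f p : ccont f p -> cdiff (fun z => (z - p) * f z) p.
Proof.
move=> fc; apply: (@cdiff_from_eps _ _ _ (f p)) => e /fc [d d0 hd].
exists d => // z /hd h.
have -> : (z - p) * f z - (p - p) * f p - f p * (z - p) = (f z - f p) * (z - p).
  by ring.
by rewrite normcM; apply: ler_wpM2r; [exact: normc_ge0|exact: ltW].
Qed.

(** Taking n-th roots absorbs the constants; Bernoulli's inequality replaces
    the limit of the roots. *)
Lemma le_of_powers (a b x y : R) : 0 < a -> 0 <= x -> 0 <= y ->
  (forall n, a * x ^+ n <= b * y ^+ n) -> x <= y.
Proof.
move=> a0 x0 y0 H; rewrite leNgt; apply/negP => yx.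
have x0' : 0 < x by apply: le_lt_trans yx.
have [y00|yn0] := eqVneq y 0.
  have := H 1%N; rewrite y00 !expr1 mulr0 leNgt mulr_gt0 //.
have yp : 0 < y by rewrite lt0r yn0.
pose q := x / y - 1.
have q0 : 0 < q by rewrite subr_gt0 ltr_pdivlMr // mul1r.
have tq : x / y = 1 + q by rewrite /q; ring.
have bern n : 1 + n%:R * q <= (x / y) ^+ n.
  rewrite tq; elim: n => [|n IH]; first by rewrite mul0r addr0 expr0.
  have : (1 + q) * (1 + n%:R * q) <= (1 + q) * (1 + q) ^+ n.
    by apply: ler_wpM2l => //; lra.
  rewrite exprS; apply: le_trans; rewrite -natr1.
  have n0 : 0 <= n%:R :> R by [].
  have := mulr_ge0 n0 (sqr_ge0 q); lra.
have H' n : a * (1 + n%:R * q) <= b.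
  have := H n; rewrite -ler_pdivrMr ?exprn_gt0 // -mulrA -expr_div_n.
  by apply: le_trans; apply: ler_wpM2l; [exact: ltW|exact: bern].
have k : b / (a * q) < (Num.truncn (b / (a * q))).+1%:R by exact: truncnS_gt.
move: k; rewrite ltr_pdivrMr ?mulr_gt0 //.
have := H' (Num.truncn (b / (a * q))).+1; lra.
Qed.

Lemma avoid_seq (s : seq C) p (d : R) : 0 < d ->
  exists2 q, N (q - p) < d & q \notin s.
Proof.
move=> d0; pose h (k : nat) : C := p + (d / (k.+2)%:R)%:C%C.
have hi : injective h.
  move=> i j /addrI [] /(mulfI (lt0r_neq0 d0)) /invr_inj /eqP.
  by rewrite eqr_nat => /eqP [].
have : has (fun q => q \notin s) (map h (iota 0 (size s).+1)).
  apply/negPn/negP => /hasPn H.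
  have : (size (map h (iota 0 (size s).+1)) <= size s)%N.
    apply: uniq_leq_size; first by rewrite map_inj_uniq // iota_uniq.
    by move=> q /H /negPn.
  by rewrite size_map size_iota ltnn.
move=> /hasP [_ /mapP [k _ ->] hk]; exists (h k) => //.
rewrite /h addrC addKr normc_real ger0_norm ?divr_ge0 ?ltW //.
by rewrite ltr_pdivrMr // ltr_pMr // ltr1n.
Qed.

(** The function P(z) f(z)^n, with P the product of the z - e over the
    exceptional points, is differentiable everywhere. The maximum principle
    bounds it by a constant times (M + e)^n, and the constant disappears as n
    grows. *)
Lemma maximum_principle_exceptional (s : seq C) f (M : R) : 0 <= M ->
  (forall z, N z < 1 -> z \notin s -> cdiff f z) ->
  (forall z, N z < 1 -> ccont f z) ->
  boundary_le f M -> forall p, N p < 1 -> N (f p) <= M.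
Proof.
move=> M0 fd fc fb.
pose P z : C := \prod_(e <- s) (z - e).
have Pd z : cdiff P z.
  rewrite /P; elim: s {fd P} => [|e s IH].
    by under eq_fun do rewrite big_nil; exact: cdiff_cst.
  under eq_fun do rewrite big_cons; exact: cdiffM.
have Pfd n z : N z < 1 -> cdiff (fun w => P w * f w ^+ n) z.
  move=> z1; have [zs|zs] := boolP (z \in s); last first.
    by apply: cdiffM => //; apply: cdiffX; exact: fd.
  have -> : (fun w => P w * f w ^+ n) =
     (fun w => (w - z) * (\prod_(e <- rem z s) (w - e) * f w ^+ n)).
    by apply/funext => w; rewrite /P (big_rem _ zs) /= mulrA.
  apply: cdiff_mul_sub; apply: ccontM; last by apply: ccontX; exact: fc.
  elim: (rem z s) => [|e t IH].
    by under eq_fun do rewrite big_nil; apply: cdiff_ccont; exact: cdiff_cst.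
  under eq_fun do rewrite big_cons; apply: ccontM => //; apply: cdiff_ccont.
  by apply: cdiffB; [exact: cdiff_id|exact: cdiff_cst].
have PB : exists2 B : R, 0 <= B & forall z, N z < 1 -> N (P z) <= B.
  rewrite /P; elim: s {fd P Pd Pfd} => [|e s [B B0 IH]].
    by exists 1 => // z _; rewrite big_nil normc1.
  exists ((1 + N e) * B) => [|z z1].
    by rewrite mulr_ge0 // addr_ge0 // normc_ge0.
  rewrite big_cons normcM; apply: ler_pM; rewrite ?normc_ge0 //; last exact: IH.
  by apply: le_trans (le_normcB _ _) _; rewrite lerD2r ltW.
have [B B0 hB] := PB.
have main p : N p < 1 -> p \notin s -> N (f p) <= M.
  move=> p1 ps; apply/ler_addgt0Pr => e e0.
  have Pp : P p != 0.
    rewrite /P prodf_seq_neq0; apply/allP => i si /=.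
    by rewrite subr_eq0; apply: contraNneq ps => ->.
  have Me : 0 <= M + e by rewrite addr_ge0 // ltW.
  apply: (@le_of_powers (N (P p)) B) => //; rewrite ?normc_gt0 ?normc_ge0 // => n.
  rewrite -normcX -normcM; apply: (@maximum_principle (fun w => P w * f w ^+ n)) => //.
    by move=> z; exact: Pfd.
  move=> e' e'0; have [r r1 hr] := fb _ e0; exists r => // z z0 z1.
  rewrite normcM normcX; apply: (@le_trans _ _ (B * (M + e) ^+ n)); last by lra.
  apply: ler_pM; rewrite ?normc_ge0 ?exprn_ge0 ?normc_ge0 //; first exact: hB.
  by apply: lerXn2r; rewrite ?nnegrE ?normc_ge0 //; exact: hr.
move=> p p1; apply/ler_addgt0Pr => e e0.
have [d d0 hd] := fc _ p1 _ e0.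
have dd : 0 < Num.min d (1 - N p) by rewrite lt_min d0 subr_gt0.
have [q] := avoid_seq s p dd; rewrite lt_min => /andP[q1 q2] qs.
have Nq : N q < 1.
  by have := le_normcD (q - p) p; rewrite subrK; lra.
have := main _ Nq qs; have := hd _ q1; have := lerB_normcB (f p) (f q).
by rewrite normcBC; lra.
Qed.

End Mobius.

(** * Divided differences, removable singularities and Schwarz's lemma *)

Section Schwarz.
Variable R : realType.
Local Notation C := R[i].
Implicit Types (f g : C -> C) (p q z w : C).

Lemma cdiff_near f g p :
  (exists2 d : R, 0 < d & forall z, N (z - p) < d -> f z = g z) ->
  cdiff f p -> cdiff g p.
Proof.
move=> [d d0 fg] /cdiff_eps [l hl]; apply: (@cdiff_from_eps _ _ _ l) => e e0.
have [d' d'0 h] := hl _ e0.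
exists (Num.min d d') => [|z]; first by rewrite lt_min d0.
rewrite lt_min => /andP[z1 z2].
by rewrite -!fg ?subrr ?normc0 //; exact: h.
Qed.

Lemma ccont_near f g p :
  (exists2 d : R, 0 < d & forall z, N (z - p) < d -> f z = g z) ->
  ccont f p -> ccont g p.
Proof.
move=> [d d0 fg] fc e e0; have [d' d'0 h] := fc _ e0.
exists (Num.min d d') => [|z]; first by rewrite lt_min d0.
rewrite lt_min => /andP[z1 z2].
by rewrite -!fg ?subrr ?normc0 //; exact: h.
Qed.

Lemma ccontB f g p : ccont f p -> ccont g p -> ccont (fun z => f z - g z) p.
Proof.
move=> h1 h2 e e0; have e2 : 0 < e / 2 by lra.
have [d1 d10 H1] := h1 _ e2; have [d2 d20 H2] := h2 _ e2.
exists (Num.min d1 d2) => [|z]; first by rewrite lt_min d10.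
rewrite lt_min => /andP[/H1 z1 /H2 z2].
have -> : f z - g z - (f p - g p) = (f z - f p) - (g z - g p) by ring.
by apply: le_lt_trans (le_normcB _ _) _; lra.
Qed.

Lemma ccont_le (s : seq C) f p (d K : R) : ccont f p -> 0 < d ->
  (forall z, N (z - p) < d -> z \notin s -> N (f z) <= K) -> N (f p) <= K.
Proof.
move=> fc d0 H; apply/ler_addgt0Pr => e e0; have [d' d'0 h] := fc _ e0.
have dd : 0 < Num.min d d' by rewrite lt_min d0.
have [q] := avoid_seq s p dd; rewrite lt_min => /andP[q1 q2] qs.
have := H _ q1 qs; have := h _ q2.
by have := lerB_normcB (f p) (f q); rewrite normcBC; lra.
Qed.

(** Near the circle |f(z) - f(w)| / |z - w| is at most 8 B, because |w| is at
    most 1/2; the maximum principle extends the bound to the disc, at the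
    price of one further exceptional point w. *)
Lemma divided_difference (s : seq C) f (B : R) w : 0 <= B ->
  (forall z, N z < 1 -> z \notin s -> cdiff f z) ->
  (forall z, N z < 1 -> ccont f z) ->
  (forall z, N z < 1 -> N (f z) <= B) ->
  N w <= 1 / 2 -> cdiff f w ->
  exists Q : C -> C, [/\
    forall z, N z < 1 -> z \notin w :: s -> cdiff Q z,
    forall z, N z < 1 -> ccont Q z,
    forall z, N z < 1 -> N (Q z) <= 8 * B &
    forall z, z != w -> Q z = (f z - f w) / (z - w)].
Proof.
move=> B0 fd fc fB w2 /cdiff_eps [l hl].
pose Q z := if z == w then l else (f z - f w) / (z - w).
have Qne z : z != w -> Q z = (f z - f w) / (z - w) by rewrite /Q => /negPf ->.
have Qnear z : z != w -> exists2 d : R, 0 < d & forall x, N (x - z) < d ->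
    (f x - f w) * (x - w)^-1 = Q x.
  move=> zw; exists (N (z - w)); first by rewrite normc_gt0 subr_eq0.
  move=> x xd; rewrite Qne //; apply: contraTneq xd => ->.
  by rewrite normcBC ltxx.
have subd z : cdiff (fun x => x - w) z.
  by apply: cdiffB; [exact: cdiff_id|exact: cdiff_cst].
have invd z : z != w -> cdiff (fun x => (x - w)^-1) z.
  by move=> zw; apply: cdiffV => //; rewrite subr_eq0.
have Qd z : N z < 1 -> z \notin w :: s -> cdiff Q z.
  rewrite inE negb_or => z1 /andP[zw zs]; apply: cdiff_near (Qnear _ zw) _.
  apply: cdiffM; last exact: invd.
  by apply: cdiffB; [exact: fd|exact: cdiff_cst].
have Qc z : N z < 1 -> ccont Q z.
  move=> z1; have [->|zw] := eqVneq z w; last first.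
    apply: ccont_near (Qnear _ zw) _; apply: ccontM; last exact/cdiff_ccont/invd.
    by apply: ccontB; [exact: fc|exact/cdiff_ccont/cdiff_cst].
  move=> e e0; have e2 : 0 < e / 2 by lra.
  have [d d0 hd] := hl _ e2; exists d => // x /hd.
  have Qw : Q w = l by rewrite /Q eqxx.
  have [->|xw] := eqVneq x w; first by rewrite !subrr normc0.
  rewrite Qne // Qw => h.
  have xw0 : x - w != 0 by rewrite subr_eq0.
  have -> : (f x - f w) / (x - w) - l = (f x - f w - l * (x - w)) / (x - w).
    by field.
  rewrite normcM normcV ltr_pdivrMr ?normc_gt0 //; apply: le_lt_trans h _.
  have := xw0; rewrite -normc_gt0 => xw1; rewrite ltr_pM2r //; lra.
exists Q; split=> // z z1.
apply: (maximum_principle_exceptional (s := w :: s)) => //; first by rewrite mulr_ge0.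
move=> e e0; exists (3 / 4); first by lra.
move=> x x0 x1.
have xw1 : 1 / 4 <= N (x - w) by have := lerB_normcB x w; lra.
have xw : x != w by rewrite -subr_eq0 -normc_gt0; lra.
rewrite Qne // normcM normcV ler_pdivrMr; last by lra.
have w1 : N w < 1 by lra.
have b1 := fB _ x1; have b2 := fB _ w1; have b3 := le_normcB (f x) (f w).
have b4 : (8 * B) * (1 / 4) <= (8 * B) * N (x - w).
  by apply: ler_wpM2l => //; rewrite mulr_ge0.
have b5 : 0 <= e * N (x - w) by rewrite mulr_ge0 ?normc_ge0 // ltW.
lra.
Qed.

(** The second divided differences of f at nonzero points are bounded by 64 B,
    since two successive divided differences cost a factor 8 each. Hence the
    first divided difference (f(z) - f(0)) / z is Lipschitz on the punctured
    disc of radius 1/2, so it has a limit at 0, with a linear error term. *)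
Lemma removable_singularity f (B : R) : 0 <= B ->
  (forall z, N z < 1 -> z != 0 -> cdiff f z) ->
  (forall z, N z < 1 -> ccont f z) ->
  (forall z, N z < 1 -> N (f z) <= B) -> cdiff f 0.
Proof.
move=> B0 fd fc fB.
have fd' z : N z < 1 -> z \notin [:: 0] -> cdiff f z.
  by move=> z1; rewrite inE => z0; exact: fd.
pose q z := (f z - f 0) / z.
pose K := 64 * B.
have K0 : 0 <= K by rewrite mulr_ge0.
have half1 (x : R) : x <= 1 / 2 -> x < 1 by move=> *; lra.
have S2 z y w : N z <= 1/2 -> N y <= 1/2 -> N w <= 1/2 ->
   z != 0 -> y != 0 -> w != 0 -> w != z -> w != y ->
   N ((f z - f w) / (z - w) - (f y - f w) / (y - w)) <= K * N (z - y).
  move=> z1 y1 w1 z0 y0 w0 wz wy.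
  have [->|zy] := eqVneq z y; first by rewrite !subrr normc0 mulr0.
  have [Q [Qd Qc Qb Qe]] := divided_difference B0 fd' fc fB w1 (fd _ (half1 _ w1) w0).
  have Qdy : cdiff Q y by apply: Qd; rewrite ?half1 // !inE negb_or eq_sym wy.
  have B8 : 0 <= 8 * B by rewrite mulr_ge0.
  have [S [_ _ Sb Se]] := divided_difference B8 Qd Qc Qb y1 Qdy.
  rewrite -!Qe ?(eq_sym _ w) //.
  have zy0 : z - y != 0 by rewrite subr_eq0.
  have := Sb _ (half1 _ z1); rewrite Se // normcM normcV ler_pdivrMr ?normc_gt0 //.
  by rewrite /K mulrA -natrM.
have S1 z y : N z <= 1/2 -> N y <= 1/2 -> z != 0 -> y != 0 ->
   N (q z - q y) <= K * N (z - y).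
  move=> z1 y1 z0 y0.
  pose phi w := (f z - f w) / (z - w) - (f y - f w) / (y - w).
  have -> : q z - q y = phi 0 by rewrite /phi /q !subr0.
  have c1 (u : C) : u != 0 -> ccont (fun w => (f u - f w) * (u - w)^-1) 0.
    move=> u0; apply: ccontM.
      apply: ccontB; first exact/cdiff_ccont/cdiff_cst.
      by apply: fc; rewrite normc0.
    apply: cdiff_ccont; apply: cdiffV; last by rewrite subr0.
    by apply: cdiffB; [exact: cdiff_cst|exact: cdiff_id].
  apply: (@ccont_le [:: 0; z; y] _ _ (1/2)); [|by []|].
    by apply: ccontB; exact: c1.
  move=> w; rewrite subr0 !inE !negb_or => w1 /and3P[w0 wz wy].
  by apply: S2 => //; exact: ltW.
(* A sequence tending to 0 in the punctured disc of radius 1/2. *)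
pose v (n : nat) : C := (n.+2%:R^-1 : R)%:C%C.
have Nv n : N (v n) = n.+2%:R^-1 by rewrite normc_real ger0_norm // invr_ge0.
have v2 n : N (v n) <= 1/2.
  by rewrite Nv div1r lef_pV2 ?posrE ?ltr0n // ler_nat.
have v0 n : v n != 0 by rewrite -normc_gt0 Nv invr_gt0 ltr0n.
have [U [UU Uo]] := ultrafilter_nat.
have qb n : N (q (v n)) <= N (q (v 0%N)) + K.
  have := S1 _ _ (v2 n) (v2 0%N) (v0 n) (v0 0%N).
  have : K * N (v n - v 0%N) <= K * 1.
    apply: ler_wpM2l => //; apply: le_trans (le_normcB _ _) _.
    by have := v2 n; have := v2 0%N; lra.
  by have := lerB_normcB (q (v n)) (q (v 0%N)); lra.
have [c hc] := ultra_limit (U := U) qb.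
have qc z : N z <= 1/2 -> z != 0 -> N (c - q z) <= K * N z.
  move=> z1 z0; apply/ler_addgt0Pr => e e0.
  apply: ultra_limit_le hc _; apply: Uo.
  exists (Num.truncn (K / e)).+1 => // n /= hn.
  apply: le_trans (S1 _ _ (v2 n) z1 (v0 n) z0) _.
  apply: (@le_trans _ _ (K * (N (v n) + N z))).
    by apply: ler_wpM2l => //; exact: le_normcB.
  rewrite mulrDr addrC lerD2l Nv ler_pdivrMr ?ltr0n // mulrC -ler_pdivrMr //.
  apply: le_trans (ltW (truncnS_gt _)) _; rewrite ler_nat.
  by apply: leq_trans hn _; rewrite -addn2 leq_addr.
apply: (@cdiff_from_eps _ _ _ c) => e e0.
pose d := Num.min (1 / 2) (e / (K + 1)).
have K1 : 0 < K + 1 by lra.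
exists d => [|z]; first by rewrite lt_min; apply/andP; split; [lra|exact: divr_gt0].
rewrite subr0 lt_min => /andP[z1 z2].
have [->|z0] := eqVneq z 0; first by rewrite mulr0 subr0 subrr normc0 mulr0.
have -> : f z - f 0 - c * z = - ((c - q z) * z) by rewrite /q; field.
rewrite normcN normcM; apply: ler_wpM2r; first exact: normc_ge0.
apply: le_trans (qc _ (ltW z1) z0) _.
move: z2; rewrite ltr_pdivlMr // => z2.
by have := normc_ge0 z; lra.
Qed.

(** Schwarz's lemma: f(z) / z extends to the whole disc, and is bounded by M
    because it is bounded by M / |z| near the circle. *)
Lemma schwarz_quotient f (M : R) : (forall z, N z < 1 -> cdiff f z) ->
  (forall z, N z < 1 -> N (f z) <= M) -> f 0 = 0 ->
  exists g : C -> C, [/\ forall z, N z < 1 -> cdiff g z,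
    forall z, N z < 1 -> N (g z) <= M & forall z, f z = z * g z].
Proof.
move=> fd fM f0.
have z1 : N (0 : C) < 1 by rewrite normc0.
have M0 : 0 <= M by apply: le_trans (fM _ z1); exact: normc_ge0.
have w2 : N (0 : C) <= 1/2 by rewrite normc0; lra.
have fd' z : N z < 1 -> z \notin [::] -> cdiff f z by move=> h _; exact: fd.
have [g [gd gc gb ge]] := divided_difference M0 fd' (fun z h => cdiff_ccont (fd z h))
   fM w2 (fd _ z1).
have {}ge z : z != 0 -> g z = f z / z by move=> /ge ->; rewrite f0 !subr0.
have gM z : N z < 1 -> N (g z) <= M.
  apply: (maximum_principle_exceptional (s := [:: 0])) => // e e0.
  have Me : 0 < M + e by lra.
  exists (M / (M + e)); first by rewrite ltr_pdivrMr //; lra.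
  move=> x x0 x1; have xp : 0 < N x by apply: le_lt_trans x0; rewrite divr_ge0 // ltW.
  rewrite ge -?normc_gt0 // normcM normcV ler_pdivrMr //.
  apply: le_trans (fM _ x1) _; move: x0; rewrite ltr_pdivrMr //; lra.
exists g; split=> //.
  move=> z h; have [->|z0] := eqVneq z 0; last by apply: gd; rewrite ?inE.
  by apply: (removable_singularity M0) => // x hx x0; apply: gd; rewrite ?inE.
by move=> z; have [->|z0] := eqVneq z 0; rewrite ?f0 ?mul0r // ge // mulrC divfK.
Qed.

(** Normalise f(p) = 1 and p = 0. For r < 1 the function r f maps the disc
    into itself, and Schwarz's lemma for its composition with mobius r gives
    |r f(z) - r| <= |z| |1 - r^2 f(z)|. For r tending to 1 this is |f(z) - 1|
    <= |z| |f(z) - 1|, so f(z) = 1. *)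
Lemma strong_maximum_disc f p : (forall z, N z < 1 -> cdiff f z) ->
  (forall z, N z < 1 -> N (f z) <= 1) -> N p < 1 -> N (f p) = 1 ->
  forall z, N z < 1 -> f z = f p.
Proof.
move=> fd fM p1 fp1.
pose h z := f (mobius (- p) z) / f p.
have fp0 : f p != 0 by rewrite -normc_gt0 fp1.
have p1' : N (- p) < 1 by rewrite normcN.
have hd z : N z < 1 -> cdiff h z.
  move=> z1; apply: cdiffM; last exact: cdiff_cst.
  apply: cdiff_comp; first by apply: cdiff_mobius => //; exact: ltW.
  by apply: fd; exact: mobius_lt1.
have hM z : N z < 1 -> N (h z) <= 1.
  by move=> z1; rewrite normcM normcV fp1 invr1 mulr1; apply: fM; exact: mobius_lt1.
have h0 : h 0 = 1.
  by rewrite /h /mobius mulr0 subr0 divr1 sub0r opprK divff.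
suff h1 z : N z < 1 -> h z = 1.
  move=> z z1; have := h1 _ (mobius_lt1 p1 z1).
  rewrite /h mobiusK // ?ltW // => /(congr1 ( *%R^~ (f p))).
  by rewrite divfK // mul1r.
move=> z1.
have main (r : R) : 0 < r -> r < 1 ->
    N (r%:C%C * h z - r%:C%C) <= N z * N (1 - (r%:C%C)^* * (r%:C%C * h z)).
  move=> r0 r1; set c : C := r%:C%C.
  have Nc : N c = r by rewrite normc_real ger0_norm // ltW.
  have Nch x : N x < 1 -> N (c * h x) < 1.
    move=> x1; rewrite normcM Nc; apply: le_lt_trans r1.
    by apply: ler_piMr; [exact: ltW|exact: hM].
  have Nc1 : N c < 1 by rewrite Nc.
  have [|||g [_ gb ge]] := @schwarz_quotient (fun x => mobius c (c * h x)) 1.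
  - move=> x x1; apply: (cdiff_comp (f := mobius c) (g := fun x => c * h x)).
      by apply: cdiffM; [exact: cdiff_cst|exact: hd].
    by apply: cdiff_mobius => //; apply/ltW/Nch.
  - by move=> x x1; apply: mobius_le1 => //; apply/ltW/Nch.
  - by rewrite h0 mulr1 mobiusxx.
  have := ge z; have := gb _ z1.
  have dn : 1 - c^* * (c * h z) != 0 by apply: mobius_den_neq0 => //; apply/ltW/Nch.
  rewrite /mobius => g1 /(congr1 ( *%R^~ (1 - c^* * (c * h z)))).
  rewrite divfK // => ->; rewrite !normcM; apply: ler_wpM2r; first exact: normc_ge0.
  by apply: ler_piMr => //; exact: normc_ge0.
suff : N (h z - 1) <= N z * N (h z - 1).
  have := normc_ge0 (h z - 1); rewrite le_eqVlt => /orP[/eqP e _|e].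
    by apply/eqP; rewrite -subr_eq0 -normc_eq0 -e.
  by rewrite -[X in X <= _]mul1r ler_pM2r // leNgt z1.
apply/ler_addgt0Pr => e e0.
pose t : R := Num.min (e / 4) (1 / 2).
have t0 : 0 < t by rewrite lt_min; apply/andP; split; lra.
have t2 : t <= 1 / 2 by rewrite ge_min lexx orbT.
have t4 : t <= e / 4 by rewrite ge_min lexx.
have r0 : 0 < 1 - t by lra.
have r1 : 1 - t < 1 by lra.
have := main _ r0 r1; set c : C := (1 - t)%:C%C.
have ct : c = 1 - t%:C%C by rewrite /c rmorphB.
have -> : c^* = c by rewrite conj_conjc /c conjc_real.
have Nt : N t%:C%C = t by rewrite normc_real ger0_norm // ltW.
have Nh := hM _ z1; have Nhz := normc_ge0 (h z).
have a1 : N (h z - 1) - 2 * t <= N (c * h z - c).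
  have -> : c * h z - c = (h z - 1) - t%:C%C * (h z - 1) by rewrite ct; ring.
  have := lerB_normcB (h z - 1) (t%:C%C * (h z - 1)); rewrite normcM Nt.
  have : t * N (h z - 1) <= t * 2.
    apply: ler_wpM2l; first exact: ltW.
    by apply: le_trans (le_normcB _ _) _; rewrite normc1; lra.
  lra.
have a2 : N (1 - c * (c * h z)) <= N (h z - 1) + 2 * t.
  have -> : 1 - c * (c * h z) = - (h z - 1) + (2 * t%:C%C - t%:C%C ^+ 2) * h z.
    by rewrite ct; ring.
  apply: le_trans (le_normcD _ _) _; rewrite normcN lerD2l normcM.
  have -> : 2 * t%:C%C - t%:C%C ^+ 2 = (2 * t - t ^+ 2)%:C%C :> C.
    by rewrite rmorphB rmorphM rmorphXn rmorph_nat.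
  rewrite normc_real ger0_norm; last by nra.
  apply: (@le_trans _ _ ((2 * t - t ^+ 2) * 1)); last by nra.
  by apply: ler_wpM2l => //; nra.
move=> a3; have a4 : N z * N (1 - c * (c * h z)) <= N z * (N (h z - 1) + 2 * t).
  by apply: ler_wpM2l => //; exact: normc_ge0.
have a5 : N z * (2 * t) <= 2 * t by apply: ler_piMl; [lra|exact: ltW].
lra.
Qed.

End Schwarz.

(** * Bounded holomorphic functions on open sets *)

Section Montel.
Variable R : realType.
Local Notation C := R[i].

(** Schwarz's lemma for f - f(0) (bounded by 2), then for g - g(0) (bounded by
    4), where f - f(0) = z g. *)
Lemma second_order_estimate (f : C -> C) : (forall z, N z < 1 -> cdiff f z) ->
  (forall z, N z < 1 -> N (f z) <= 1) ->
  exists2 l : C, N l <= 2 &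
    forall t, N t < 1 -> N (f t - f 0 - l * t) <= 4 * N t ^+ 2.
Proof.
move=> fd fM.
have z1 : N (0 : C) < 1 by rewrite normc0.
have [|||g [gd gb ge]] := @schwarz_quotient R (fun z => f z - f 0) 2.
- by move=> z h; apply: cdiffB; [exact: fd|exact: cdiff_cst].
- move=> z h; apply: le_trans (le_normcB _ _) _; have := fM _ h; have := fM _ z1; lra.
- by rewrite subrr.
have [|||k [_ kb ke]] := @schwarz_quotient R (fun z => g z - g 0) 4.
- by move=> z h; apply: cdiffB; [exact: gd|exact: cdiff_cst].
- move=> z h; apply: le_trans (le_normcB _ _) _; have := gb _ h; have := gb _ z1; lra.
- by rewrite subrr.
exists (g 0); first exact: gb.
move=> t t1.
have -> : f t - f 0 - g 0 * t = t * (t * k t) by rewrite ge -ke; ring.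
rewrite !normcM expr2.
by have := ler_wpM2l (mulr_ge0 (normc_ge0 t) (normc_ge0 t)) (kb _ t1); lra.
Qed.

Section V.
Variable V : normedModType R[i].

(** The second order estimate on the complex line through p in direction h.
    The constants depend on the radius only, not on f. *)
Lemma cauchy_estimates (f : V -> R[i]^o) (p : V) (r : R) : 0 < r ->
  (forall h, nrm h < r -> differentiable f (p + h) /\ N (f (p + h)) <= 1) ->
  (forall h, N ('d f p h) <= 4 / r * nrm h) /\
  (forall h, nrm h < r / 2 ->
     N (f (p + h) - f p - 'd f p h) <= 16 / r ^+ 2 * nrm h ^+ 2).
Proof.
move=> r0 H.
have main (u : V) : nrm u = r / 2 ->
   N ('d f p u) <= 2 /\ forall t, N t < 1 ->
    N (f (p + t *: u) - f p - 'd f p (t *: u)) <= 4 * N t ^+ 2.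
  move=> ur; pose g (t : C) : C := f (p + t *: u).
  have tu t : N t < 1 -> nrm (t *: u) < r.
    by move=> t1; rewrite nrmZ ur; have := ler_piMl (ltW r0) (ltW t1); lra.
  have gd t : N t < 1 -> cdiff g t.
    move=> t1; have [fd _] := H _ (tu _ t1).
    pose lin (s : R[i]^o) : V := p + s *: u.
    have ld : differentiable lin (t : R[i]^o).
      by apply: differentiableD => //; exact: differentiable_cst.
    exact: (@differentiable_comp _ R[i]^o V R[i]^o lin f t ld fd).
  have gM t : N t < 1 -> N (g t) <= 1 by move=> /tu /H [].
  have [l l2 hl] := second_order_estimate gd gM.
  have g0 : g 0 = f p by rewrite /g scale0r addr0.
  have fd0 : differentiable f p.
    by have [] := H 0; rewrite ?nrm0 ?addr0.
  have el : l = 'd f p u.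
    apply/eqP; rewrite -subr_eq0 -normc_eq0; apply/eqP/le_anti; rewrite normc_ge0 andbT.
    apply/ler_addgt0Pr => e e0; rewrite add0r.
    have e1 : 0 < e / r by exact: divr_gt0.
    have [d d0 hd] := diff_eps fd0 e1.
    pose t0 : R := Num.min (1/2) (Num.min (e / 8) (d / r)).
    have t00 : 0 < t0 by rewrite !lt_min divr_gt0 // !divr_gt0.
    have t01 : t0 <= 1/2 by rewrite ge_min lexx.
    have t02 : t0 <= e / 8 by rewrite !ge_min lexx orbT.
    have t03 : t0 <= d / r by rewrite !ge_min lexx !orbT.
    pose t : C := t0%:C%C.
    have Nt : N t = t0 by rewrite normc_real ger0_norm // ltW.
    have td : nrm (t *: u) < d.
      rewrite nrmZ ur Nt; move: t03; rewrite ler_pdivlMr //.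
      by have := mulr_gt0 t00 r0; lra.
    have t1 : N t < 1 by rewrite Nt; lra.
    have := hd _ td; rewrite nrmC -/(g t) -g0 linearZ /= nrmZ Nt ur => h1.
    have := hl _ t1; rewrite Nt => h2.
    have : N ((l - 'd f p u) * t) <= e * t0.
      have -> : (l - 'd f p u) * t =
        (g t - g 0 - t *: 'd f p u) - (g t - g 0 - l * t).
        by rewrite -[t *: _]/(t * _); ring.
      apply: le_trans (le_normcB _ _) _; rewrite -/(g t) in h1.
      have h3 : e / r * (t0 * (r / 2)) = e * t0 / 2 by field; rewrite gt_eqF.
      have h4 : 4 * t0 ^+ 2 <= 4 * (e / 8 * t0).
        by rewrite expr2; apply: ler_wpM2l => //; apply: ler_wpM2r => //; exact: ltW.
      rewrite h3 in h1; lra.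
    by rewrite normcM Nt ler_pM2r.
  rewrite -el; split=> // t t1; rewrite linearZ /= -el -/(g t) -g0.
  by rewrite -[t *: l]/(t * l) [t * l]mulrC; exact: hl.
(* The direction is scaled to half the radius, so that the unit disc is
   mapped inside the ball of radius r. *)
have dir h : h != 0 -> exists u : V, [/\ nrm u = r / 2 &
    h = (2 / r * nrm h)%:C%C *: u].
  move=> h0; exists ((r / 2 / nrm h)%:C%C *: h).
  have n0 : 0 < nrm h by rewrite nrm_gt0.
  have q0 : 0 < r / 2 / nrm h by apply: divr_gt0 => //; lra.
  split; first by rewrite nrmZ normc_real ger0_norm ?ltW // divfK // gt_eqF.
  rewrite scalerA -rmorphM; have -> : 2 / r * nrm h * (r / 2 / nrm h) = 1.
    by field; rewrite !gt_eqF.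
  by rewrite rmorph1 scale1r.
split=> h; have [->|h0] := eqVneq h 0.
- by rewrite linear0 normc0 nrm0 mulr0.
- have [u [ur he]] := dir _ h0; have [d2 _] := main _ ur.
  have q0 : 0 <= 2 / r * nrm h by rewrite mulr_ge0 ?nrm_ge0 // divr_ge0 // ltW.
  rewrite {1}he linearZ /= -[_ *: _]/(_ * _) normcM normc_real ger0_norm //.
  have -> : 4 / r * nrm h = (2 / r * nrm h) * 2 by ring.
  exact: ler_wpM2l.
- by move=> _; rewrite addr0 linear0 subrr subr0 normc0 nrm0 expr0n mulr0.
- move=> hr; have [u [ur he]] := dir _ h0; have [_ d2] := main _ ur.
  have q0 : 0 <= 2 / r * nrm h by rewrite mulr_ge0 ?nrm_ge0 // divr_ge0 // ltW.
  have Nt : N (2 / r * nrm h)%:C%C = 2 / r * nrm h by rewrite normc_real ger0_norm.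
  have t1 : N (2 / r * nrm h)%:C%C < 1.
    by rewrite Nt mulrAC ltr_pdivrMr // mul1r; lra.
  have := d2 _ t1; rewrite -he Nt; congr (is_true (_ <= _)).
  by field; rewrite gt_eqF.
Qed.

Variables (U : set_system nat) (Omega : set V).
Context {UU : UltraFilter U}.

(** The differentials of fs n at p are uniformly bounded linear maps, so they
    have a pointwise limit L, which is linear. The Taylor estimates of fs n do
    not depend on n, so they pass to the limit and show that L is the
    differential of f. *)
Lemma montel_ultra_limit (fs : nat -> V -> R[i]^o) (f : V -> R[i]^o) :
  open Omega ->
  (forall n x, Omega x -> differentiable (fs n) x /\ N (fs n x) <= 1) ->
  (forall x, Omega x -> forall e, 0 < e -> U [set n | N (fs n x - f x) < e]) ->
  forall x, Omega x -> differentiable f x.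
Proof.
move=> Oo fsd fl p Op.
have [r r0 hr] : exists2 r : R, 0 < r & forall h, nrm h < r -> Omega (p + h).
  have /near_nrm [r r0 h] : \forall x \near p, Omega x by exact: open_nbhs_nbhs.
  by exists r => // k kr; apply: h; rewrite addrC addKr.
have est n := @cauchy_estimates (fs n) p r r0 (fun h hh => fsd n _ (hr h hh)).
have /choice [L hL] : forall h, exists l, forall e, 0 < e ->
    U [set n | N ('d (fs n) p h - l) < e].
  by move=> h; apply: (ultra_limit (M := 4 / r * nrm h)) => n; have [h1 _] := est n.
have Llin : linear (L : V -> R[i]^o).
  move=> a h k; rewrite -[a *: L h]/(a * L h).
  apply/eqP; rewrite -subr_eq0 -normc_eq0; apply/eqP/le_anti; rewrite normc_ge0 andbT.
  apply/ler_addgt0Pr => e e0; rewrite add0r.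
  apply: (ultra_limit_le (hL (a *: h + k))).
  have Na : 0 < N a + 1 by rewrite ltr_wpDl ?normc_ge0.
  have ea : 0 < e / 2 / (N a + 1) by apply: divr_gt0 => //; lra.
  have e2 : 0 < e / 2 by lra.
  apply: filterS2 (hL h _ ea) (hL k _ e2) => n /=; rewrite ltr_pdivlMr // => h1 h2.
  rewrite linearP -[a *: 'd (fs n) p h]/(a * _).
  have -> : a * 'd (fs n) p h + 'd (fs n) p k - (a * L h + L k) =
    a * ('d (fs n) p h - L h) + ('d (fs n) p k - L k) by ring.
  apply: le_trans (le_normcD _ _) _; rewrite normcM.
  by have := normc_ge0 ('d (fs n) p h - L h); lra.
pose LL : {linear V -> R[i]^o} :=
  HB.pack (L : V -> R[i]^o) (GRing.isLinear.Build _ _ _ _ (L : V -> R[i]^o) Llin).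
apply: (@diff_from_eps _ _ _ _ _ LL (4 / r)) => [h|e e0].
  rewrite nrmC -[LL h]subr0; apply: (ultra_limit_le (hL h)).
  apply: filterS (@filterT _ U _) => n _ /=; rewrite subr0.
  by have [h1 _] := est n.
have rem h : nrm h < r / 2 ->
    N (f (p + h) - f p - L h) <= 16 / r ^+ 2 * nrm h ^+ 2.
  move=> h2; apply/ler_addgt0Pr => u u0.
  have u3 : 0 < u / 3 by lra.
  have Oph : Omega (p + h) by apply: hr; lra.
  have [n [/= [h4 h5] h6]] := filter_ex
     (filterI (filterI (fl _ Oph _ u3) (fl _ Op _ u3)) (hL h _ u3)).
  have [_ /(_ _ h2) h7] := est n.
  have -> : f (p + h) - f p - L h = (fs n (p + h) - fs n p - 'd (fs n) p h)
    - (fs n (p + h) - f (p + h)) + ((fs n p - f p) + ('d (fs n) p h - L h)).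
    by rewrite /=; ring.
  apply: le_trans (le_normcD _ _) _.
  apply: le_trans (lerD (le_normcB _ _) (le_normcD _ _)) _; lra.
have K0 : 0 < 16 / r ^+ 2 by rewrite divr_gt0 // exprn_gt0.
exists (Num.min (r / 2) (e / (16 / r ^+ 2))).
  by rewrite lt_min; apply/andP; split; [lra|exact: divr_gt0].
move=> h; rewrite lt_min => /andP[h1 h2]; rewrite !nrmC.
apply: le_trans (rem _ h1) _; rewrite expr2 mulrA.
apply: ler_wpM2r; first exact: nrm_ge0.
by move: h2; rewrite ltr_pdivlMr // mulrC => /ltW.
Qed.

(** The set where f equals f(p) is closed by continuity; it is open by the
    strong maximum principle on the complex lines through one of its points. *)
Lemma strong_maximum_domain (f : V -> R[i]^o) p :
  open Omega -> connected Omega ->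
  (forall x, Omega x -> differentiable f x /\ N (f x) <= 1) ->
  Omega p -> N (f p) = 1 -> forall x, Omega x -> f x = f p.
Proof.
move=> Oo Oc fd Op fp1.
pose B := Omega `&` [set x | f x = f p].
have ball_eq x : B x -> exists2 r : R, 0 < r & forall y, nrm (y - x) < r -> B y.
  move=> [Ox /= fx].
  have /near_nrm [r r0 h] : \forall y \near x, Omega y by exact: open_nbhs_nbhs.
  exists (r / 2); first by lra.
  move=> y yr; split; first by apply: h; lra.
  (* The line is scaled so that y is reached at s = 1/2. *)
  pose lin (s : R[i]^o) : V := x + s *: (2 *: (y - x)).
  have ls s : N s < 1 -> Omega (lin s).
    move=> s1; apply: h; rewrite /lin addrC addKr !nrmZ normc_nat.
    have y0 := nrm_ge0 (y - x).
    have : N s * (2 * nrm (y - x)) <= 2 * nrm (y - x).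
      by apply: ler_piMl; [rewrite mulr_ge0|exact: ltW].
    lra.
  have z1 : N (0 : C) < 1 by rewrite normc0.
  have h2 : N (2^-1 : C) < 1 by rewrite normcV normc_nat; lra.
  have l0 : lin 0 = x by rewrite /lin scale0r addr0.
  have l1 : lin (2^-1) = y.
    by rewrite /lin scalerA mulVf ?pnatr_eq0 // scale1r addrC subrK.
  have fld s : N s < 1 -> cdiff (fun s => f (lin s)) s.
    move=> s1; have [fds _] := fd _ (ls _ s1).
    have ld : differentiable lin (s : R[i]^o).
      by apply: differentiableD => //; exact: differentiable_cst.
    exact: (@differentiable_comp _ R[i]^o V R[i]^o lin f s ld fds).
  have flM s : N s < 1 -> N (f (lin s)) <= 1.
    by move=> s1; have [] := fd _ (ls _ s1).
  have fl0 : N (f (lin 0)) = 1 by rewrite l0 fx.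
  by have := strong_maximum_disc fld flM z1 fl0 h2; rewrite l0 l1 fx.
have Bo : open B.
  rewrite openE => x /ball_eq [r r0 h]; apply/near_nrm; by exists r.
suff BO : B = Omega by move=> x; rewrite -BO => - [].
apply: Oc.
- by exists p.
- by exists B => //; rewrite /B setIA setIid.
- exists (closure B); first exact: closed_closure.
  apply/seteqP; split=> [x Bx|x [Ox cx]].
    by split; [case: Bx|exact: subset_closure].
  split=> //=; have [fdx _] := fd _ Ox.
  apply/eqP; rewrite -subr_eq0 -normc_eq0; apply/eqP/le_anti; rewrite normc_ge0 andbT.
  apply/ler_addgt0Pr => e e0; rewrite add0r.
  have [d d0 hd] := diff_cont_eps fdx e0.
  have [y [[_ fy] yd]] : B `&` [set y | nrm (y - x) < d] !=set0.
    by apply: cx; apply/near_nrm; exists d.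
  by have := hd _ yd; rewrite nrmC fy normcBC => /ltW.
Qed.

End V.

End Montel.

(** * Finite Blaschke products *)

Section Blaschke.
Variable R : realType.
Local Notation C := R[i].
Implicit Types (f g B : R[i]^o -> R[i]^o) (p q z w : C).

Lemma blaschkeP d B : blaschke_product d B <->
  exists (c : C) (a : 'I_d -> C), [/\ N c = 1, forall k, N (a k) < 1 &
    forall w, N w < 1 -> B w = c * \prod_(k < d) mobius (a k) w].
Proof.
split=> -[c [a [h1 h2 h3]]]; exists c, a; split.
- by apply: (@complexI R); rewrite -normr_normc h1.
- by move=> k; rewrite -disc_normc.
- by move=> w w1; apply: h3; rewrite disc_normc.
- by rewrite normr_normc h1.
- by move=> k; rewrite disc_normc.
- by move=> w; rewrite disc_normc => /h3.
Qed.

Lemma blaschke_ext d f g : (forall w, N w < 1 -> f w = g w) ->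
  blaschke_product d f -> blaschke_product d g.
Proof.
move=> fg /blaschkeP [c [a [h1 h2 h3]]]; apply/blaschkeP; exists c, a.
by split=> // w w1; rewrite -fg // h3.
Qed.

Lemma blaschke_mul d f g p : N p < 1 -> blaschke_product d g ->
  (forall w, N w < 1 -> f w = mobius p w * g w) -> blaschke_product d.+1 f.
Proof.
move=> p1 /blaschkeP [c [a [h1 h2 h3]]] fg; apply/blaschkeP.
exists c, (fun i => if unlift ord0 i is Some j then a j else p); split=> //.
  by move=> k; case: unliftP.
move=> w w1; rewrite fg // h3 // big_ord_recl unlift_none mulrCA.
by congr (_ * (_ * _)); apply: eq_bigr => i _; rewrite liftK.
Qed.

Lemma blaschke_split d f p : N p < 1 -> blaschke_product d.+1 f -> f p = 0 ->
  exists2 g, blaschke_product d g & forall w, N w < 1 -> f w = mobius p w * g w.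
Proof.
move=> p1 /blaschkeP [c [a [h1 h2 h3]]]; rewrite h3 // => /eqP.
have c0 : c != 0 by rewrite -normc_gt0 h1.
rewrite mulf_eq0 (negPf c0) /= => /prodf_eq0 [k _].
rewrite mobius_eq0 ?ltW // => /eqP pk.
exists (fun w => c * \prod_(j < d) mobius (a (lift k j)) w).
  by apply/blaschkeP; exists c, (fun j => a (lift k j)).
by move=> w w1; rewrite h3 // (bigD1_ord k) //= -pk mulrCA.
Qed.

(** The size is only bounded from above: the factors with b k = 0 have degree
    0. *)
Lemma reversed_prod_coef d (b : 'I_d -> C) :
  let P := \prod_(k < d) (1 - b k *: 'X) : {poly C} in
  (size P <= d.+1)%N /\ P`_d = \prod_(k < d) (- b k).
Proof.
elim: d b => [|d IH] b /=; first by rewrite !big_ord0 size_poly1 coef1.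
have [/= s1 s2] := IH (fun i => b (lift ord0 i)).
rewrite !big_ord_recl; set Q := \prod_(i < d) _ in s1 s2 *.
have Qd : Q`_d.+1 = 0 by rewrite nth_default.
split.
  rewrite mulrBl mul1r -scalerAl; apply: leq_trans (size_polyD _ _) _.
  rewrite geq_max (leq_trans s1) //= size_polyN.
  apply: leq_trans (size_scale_leq _ _) _.
  have [->|Q0] := eqVneq Q 0; first by rewrite mulr0 size_poly0.
  by rewrite mulrC size_mulX.
by rewrite mulrBl mul1r -scalerAl coefB coefZ coefXM /= Qd s2 sub0r mulNr.
Qed.

Lemma normc_prod (I : Type) (r : seq I) (F : I -> C) :
  N (\prod_(i <- r) F i) = \prod_(i <- r) N (F i).
Proof. by apply: (big_morph _ (@normcM R) (normc1 R)). Qed.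

(** Outside the disc a Blaschke factor has modulus at least 1. *)
Lemma mobius_factor_le p z : N p < 1 -> 1 <= N z -> N (1 - p^* * z) <= N (z - p).
Proof.
move=> p1 z1; rewrite -(@ler_pXn2r _ 2) ?nnegrE ?normc_ge0 //.
rewrite -subr_le0 mobius_sqr_identity.
apply: mulr_ge0_le0; first by rewrite subr_ge0 expr_le1 ?normc_ge0 // ltW.
by rewrite subr_le0 expr_ge1 ?normc_ge0.
Qed.

Lemma mobius_frac q x y : y != 0 -> mobius q (x / y) = (x - q * y) / (y - q^* * x).
Proof.
move=> y0; rewrite /mobius.
have -> : x / y - q = (x - q * y) / y by field.
have -> : 1 - q^* * (x / y) = (y - q^* * x) / y by field.
by rewrite invfM invrK -mulrA [y^-1 * _]mulrCA mulVf // mulr1.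
Qed.

(** Write f = c A / D. The numerator P = c A - q D of mobius q o f has degree
    exactly d, since the modulus of its leading coefficient is at least 1 -
    |q|. Its roots lie in the disc: outside, |A| >= |D|, so |c A| = |q D|
    forces A = 0. The denominator D - conj q c A is c times the polynomial
    obtained from P by reversing and conjugating the coefficients, so its
    factors are 1 - conj z w for the same roots z. *)
Lemma blaschke_mobius d f q : N q < 1 -> blaschke_product d f ->
  blaschke_product d (fun w => mobius q (f w)).
Proof.
move=> q1 /blaschkeP [c [a [c1 a1 fE]]].
pose A : {poly C} := \prod_(k < d) ('X - (a k)%:P).
pose D : {poly C} := \prod_(k < d) (1 - (a k)^* *: 'X).
have AE w : A.[w] = \prod_(k < d) (w - a k).
  by rewrite horner_prod; apply: eq_bigr => k _; rewrite !hornerE.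
have DE w : D.[w] = \prod_(k < d) (1 - (a k)^* * w).
  by rewrite horner_prod; apply: eq_bigr => k _; rewrite !hornerE.
have [Ds Dd] := reversed_prod_coef (fun k => (a k)^*).
rewrite /= -/D in Ds Dd.
have As : size A = d.+1 by rewrite size_prod_XsubC /index_enum -enumT size_enum_ord.
have Ad : A`_d = 1.
  have := monic_prod_XsubC (index_enum 'I_d) xpredT a.
  by rewrite -/A monicE /lead_coef As => /eqP.
pose P := c *: A - q *: D.
pose l := c - q * \prod_(k < d) (- (a k)^*).
have Pd : P`_d = l by rewrite /P coefB !coefZ Ad Dd mulr1.
have l0 : l != 0.
  rewrite /l subr_eq0; apply/eqP => /(congr1 (@Normc.normc R)).
  rewrite c1 normcM normc_prod => e1.
  have : \prod_(i < d) N (- (a i)^*) <= 1.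
    by apply: prodr_ile1 => i _; rewrite normc_ge0 normcN normc_conj ltW.
  by move/(ler_wpM2l (normc_ge0 q)); lra.
have Ps : size P = d.+1.
  apply/eqP; rewrite eqn_leq; apply/andP; split; last first.
    by rewrite ltnNge; apply/negP => /(nth_default 0); rewrite Pd; exact/eqP.
  apply: leq_trans (size_polyD _ _) _; rewrite geq_max size_polyN.
  by rewrite !(leq_trans (size_scale_leq _ _)) // As.
have Pl : lead_coef P = l by rewrite /lead_coef Ps.
have [r rE] := closed_field_poly_normal P.
rewrite Pl in rE.
have rs : size r = d.
  by move: Ps; rewrite rE size_scale // size_prod_XsubC => -[].
have PE w : P.[w] = l * \prod_(z <- r) (w - z).
  rewrite rE hornerZ horner_prod; congr (_ * _).
  by apply: eq_bigr => z _; rewrite !hornerE.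
have PE2 w : P.[w] = c * A.[w] - q * D.[w] by rewrite /P !hornerE.
have r1 z : z \in r -> N z < 1.
  move=> zr; rewrite ltNge; apply/negP => z1.
  have : P.[z] = 0.
    by rewrite PE (big_rem _ zr) /= subrr mul0r mulr0.
  rewrite PE2 => /eqP; rewrite subr_eq0 => /eqP /(congr1 (@Normc.normc R)).
  rewrite !normcM c1 mul1r AE DE !normc_prod => e1.
  have DA : \prod_(k < d) N (1 - (a k)^* * z) <= \prod_(k < d) N (z - a k).
    apply: ler_prod => i _; rewrite normc_ge0 /=; exact: mobius_factor_le.
  have A0 : \prod_(k < d) N (z - a k) = 0.
    apply/le_anti; rewrite prodr_ge0 ?andbT; last by move=> *; exact: normc_ge0.
    move: e1; set x := \prod_(i < d) _ in DA *; set y := \prod_(i < d) _ in DA *.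
    move=> e1; have h : N q * x <= N q * y by apply: ler_wpM2l => //; exact: normc_ge0.
    have q2 : 0 < 1 - N q by lra.
    by rewrite -(pmulr_rle0 _ q2); lra.
  move/eqP: A0 => /prodf_eq0 [k _]; rewrite normc_eq0 subr_eq0 => /eqP zk.
  by have := a1 k; rewrite -zk ltNge z1.
have cJ : c * c^* = 1 by rewrite -sqr_normc_conj c1 expr1n.
have key w : D.[w] - q^* * (c * A.[w]) = c * l^* * \prod_(z <- r) (1 - z^* * w).
  have [->|w0] := eqVneq w 0.
    rewrite AE DE.
    rewrite [X in X - _ = _]big1 => [|k _]; last by rewrite mulr0 subr0.
    rewrite [X in _ = _ * X]big1 => [|z _]; last by rewrite mulr0 subr0.
    rewrite mulr1 /l rmorphB rmorphM rmorph_prod mulrBr cJ; congr (_ - _).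
    rewrite mulrCA; congr (_ * (_ * _)); apply: eq_bigr => k _.
    by rewrite sub0r rmorphN /= conjCK.
  (* Conjugating P at the reflected point v and multiplying by w ^+ d
     evaluates the reversed polynomial at w. *)
  pose v := (w^*)^-1.
  have vJ : v^* = w^-1 by rewrite /v fmorphV /= conjCK.
  have prodJ (s : seq C) : (\prod_(z <- s) (v - z))^* * w ^+ size s =
      \prod_(z <- s) (1 - z^* * w).
    elim: s => [|z s IH]; first by rewrite !big_nil rmorph1 mul1r expr0.
    rewrite !big_cons rmorphM exprS /= mulrACA IH; congr (_ * _).
    by rewrite rmorphB /= vJ mulrBl mulVf.
  pose sa := [seq a k | k <- enum 'I_d].
  have sas : size sa = d by rewrite size_map size_enum_ord.
  have As' x : A.[x] = \prod_(z <- sa) (x - z) by rewrite AE big_map big_enum.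
  have Ds' x : D.[x] = \prod_(z <- sa) (1 - z^* * x) by rewrite DE big_map big_enum.
  have prodA : (A.[v])^* * w ^+ d = D.[w] by rewrite As' Ds' -prodJ sas.
  have prodD : (D.[v])^* * w ^+ d = A.[w].
    rewrite As' Ds' -sas; elim: sa {sas As' Ds' prodA} => [|z s IH].
      by rewrite !big_nil rmorph1 mul1r expr0.
    rewrite !big_cons rmorphM exprS /= mulrACA IH; congr (_ * _).
    rewrite rmorphB rmorphM rmorph1 /= conjCK vJ mulrBl mul1r -mulrA mulVf //.
    by rewrite mulr1.
  have : (P.[v])^* * w ^+ d = l^* * \prod_(z <- r) (1 - z^* * w).
    by rewrite PE rmorphM -mulrA -{1}rs prodJ.
  rewrite PE2 rmorphB !rmorphM mulrBl -!mulrA prodA prodD => /(congr1 ( *%R c)).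
  rewrite mulrBr !mulrA cJ mul1r => <-; congr (_ - _); congr (_ * _).
  by rewrite mulrC.
apply/blaschkeP; exists (l / (c * l^*)), (fun k => nth 0 r k); split.
- rewrite normcM normcV normcM c1 mul1r normc_conj divff // normc_eq0 //.
- by move=> k; apply: r1; rewrite mem_nth // rs.
move=> w w1; have D0 : D.[w] != 0.
  by rewrite DE; apply/prodf_neq0 => k _; apply: mobius_den_neq0 => //; exact: ltW.
have fw : f w = c * A.[w] / D.[w].
  by rewrite fE // AE DE -mulrA -prodf_div.
have -> : mobius q (f w) = P.[w] / (D.[w] - q^* * (c * A.[w])).
  by rewrite PE2 fw mobius_frac.
rewrite key PE.
have prodE : \prod_(k < d) mobius r`_k w =
    (\prod_(z <- r) (w - z)) / \prod_(z <- r) (1 - z^* * w).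
  by rewrite -prodf_div [RHS](big_nth 0) big_mkord rs.
by rewrite prodE mulf_div.
Qed.

End Blaschke.

(** * Interpolation by bounded functions on the disc *)

Section Interp.
Variable R : realType.
Local Notation C := R[i].
Implicit Types (f g h B : R[i]^o -> R[i]^o) (p q z w u : C).

(** Schwarz's lemma at 0, transported by mobius (- p). *)
Lemma schwarz_quotient_at f (M : R) p : (forall z, N z < 1 -> cdiff f z) ->
  (forall z, N z < 1 -> N (f z) <= M) -> N p < 1 -> f p = 0 ->
  exists g, [/\ forall z, N z < 1 -> cdiff g z,
    forall z, N z < 1 -> N (g z) <= M &
    forall z, N z < 1 -> f z = mobius p z * g z].
Proof.
move=> fd fM p1 fp; have p1' : N (- p) < 1 by rewrite normcN.
have [|||g [gd gM ge]] := @schwarz_quotient R (fun z => f (mobius (- p) z)) M.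
- move=> z z1; apply: (@cdiff_comp R f (mobius (- p))).
    by apply: cdiff_mobius => //; exact: ltW.
  by apply: fd; exact: mobius_lt1.
- by move=> z z1; apply: fM; exact: mobius_lt1.
- by rewrite /mobius mulr0 subr0 divr1 sub0r opprK.
exists (fun z => g (mobius p z)); split.
- move=> z z1; apply: (@cdiff_comp R g (mobius p)).
    by apply: cdiff_mobius => //; exact: ltW.
  by apply: gd; exact: mobius_lt1.
- by move=> z z1; apply: gM; exact: mobius_lt1.
- by move=> z z1; rewrite -ge mobiusK // ltW.
Qed.

(** For |u| <= s < 1 the quantity 1 - |mobius q u|^2 is at least (1 - |q|^2)
    (1 - s^2) / 4. *)
Lemma mobius_bound q (t : R) : N q < 1 -> t < 1 ->
  exists2 t' : R, t' < 1 & forall u, N u <= t -> N (mobius q u) <= t'.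
Proof.
move=> q1 t1; pose s := Num.max t 0.
have s0 : 0 <= s by rewrite le_max lexx orbT.
have s1 : s < 1 by rewrite gt_max t1 ltr01.
have ts : t <= s by rewrite le_max lexx.
pose k := (1 - N q ^+ 2) * (1 - s ^+ 2) / 4.
have q2 : 0 < 1 - N q ^+ 2 by rewrite subr_gt0 sqr_lt1 ?normc_ge0.
have s2 : 0 < 1 - s ^+ 2 by rewrite subr_gt0 sqr_lt1.
have k0 : 0 < k by rewrite divr_gt0 ?(mulr_gt0 q2 s2).
have k1 : k <= 1.
  have : (1 - N q ^+ 2) * (1 - s ^+ 2) <= 1 * 1.
    by apply: ler_pM; [exact: ltW|exact: ltW| |]; rewrite gerBl ?sqr_ge0.
  by rewrite /k; lra.
exists (1 - k / 2) => [|u ut]; first by lra.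
have us : N u <= s by apply: le_trans ts.
have u1 : N u <= 1 by apply: le_trans (ltW s1).
rewrite -(@ler_pXn2r _ 2) ?nnegrE ?normc_ge0 //; last by lra.
have D0 : 0 < N (1 - q^* * u) ^+ 2 by rewrite exprn_gt0 // normc_gt0 mobius_den_neq0.
have D4 : N (1 - q^* * u) ^+ 2 <= 4.
  have -> : 4 = 2 ^+ 2 :> R by rewrite -natrX.
  apply: lerXn2r; rewrite ?nnegrE ?normc_ge0 //.
  apply: le_trans (le_normcB _ _) _; rewrite normc1 normcM normc_conj.
  by have := ler_piMl (normc_ge0 u) (ltW q1); lra.
have : k <= 1 - N (mobius q u) ^+ 2.
  rewrite one_sub_mobius_sqr // /k; apply: (@le_trans _ _
    ((1 - N q ^+ 2) * (1 - s ^+ 2) / N (1 - q^* * u) ^+ 2)).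
    apply: ler_wpM2l; first by rewrite ltW // mulr_gt0.
    by rewrite lef_pV2 ?posrE.
  apply: ler_wpM2r; first by rewrite invr_ge0 ltW.
  apply: ler_wpM2l; first exact: ltW.
  by rewrite lerD2l lerN2; apply: lerXn2r; rewrite ?nnegrE ?normc_ge0.
have := sqr_ge0 k; rewrite !expr2; lra.
Qed.

(** Induction on d. Composing B and h with mobius q, where q is the common
    value at p, gives two functions vanishing at p; dividing both by mobius p
    leaves a Blaschke product of degree one less and a function with a bound
    below 1, which agree at the remaining points. In degree 0 a unimodular
    constant would be bounded by t. *)
Lemma blaschke_interpolation_rigid d B h (t : R) (lam : seq C) : blaschke_product d B ->
  t < 1 -> (forall z, N z < 1 -> cdiff h z) ->
  (forall z, N z < 1 -> N (h z) <= t) ->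
  uniq lam -> (d < size lam)%N -> (forall x, x \in lam -> N x < 1) ->
  (forall x, x \in lam -> B x = h x) -> False.
Proof.
elim: d B h t lam => [|d IH] B h t [//|p lam] Bb t1 hd ht /= /andP[plam lamu] ls l1 Bh.
  have p1 : N p < 1 by apply: l1; rewrite mem_head.
  have := ht _ p1; rewrite -Bh ?mem_head //.
  have /blaschkeP [c [a [c1 _ ->]]] := Bb => //.
  by rewrite big_ord0 mulr1 c1; lra.
have p1 : N p < 1 by apply: l1; rewrite mem_head.
pose q := h p.
have q1 : N q < 1 by apply: le_lt_trans t1; exact: ht.
have hle1 z : N z < 1 -> N (h z) <= 1 by move=> /ht /le_trans; apply; exact: ltW.
have Bp : B p = q by apply: Bh; rewrite mem_head.
have [B2 B2b B2e] := blaschke_split p1 (blaschke_mobius q1 Bb)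
   (etrans (congr1 (mobius q) Bp) (mobiusxx q)).
have [t' t'1 ht'] := mobius_bound q1 t1.
have [|||h2 [h2d h2M h2e]] := @schwarz_quotient_at
  (fun z => mobius q (h z)) t' p _ _ p1 _.
- move=> z z1; apply: (@cdiff_comp R (mobius q) h); first exact: hd.
  by apply: cdiff_mobius => //; exact: hle1.
- by move=> z z1; apply: ht'; exact: ht.
- exact: mobiusxx.
apply: (IH B2 h2 t' lam) => //.
- by move=> x xl; apply: l1; rewrite in_cons xl orbT.
- move=> x xl; have x1 : N x < 1 by apply: l1; rewrite in_cons xl orbT.
  have mx : mobius p x != 0.
    by rewrite mobius_eq0 ?ltW //; apply: contraNneq plam => <-.
  apply: (mulfI mx); rewrite -B2e // -h2e //; congr (mobius q _).
  by apply: Bh; rewrite in_cons xl orbT.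
Qed.

Lemma mobius_cont q u (eta : R) : N q < 1 -> N u < 1 -> 0 < eta ->
  exists2 e : R, 0 < e & forall q' u', N (q' - q) < e -> N (u' - u) < e ->
    [/\ N q' < 1, N u' < 1 & N (mobius q' u' - mobius q u) < eta].
Proof.
move=> q1 u1 eta0; pose m := Num.max (N q) (N u).
have m1 : m < 1 by rewrite gt_max q1 u1.
have m0 : 0 <= m by rewrite le_max normc_ge0.
have qm : N q <= m by rewrite le_max lexx.
have um : N u <= m by rewrite le_max lexx orbT.
pose k := (1 - m) / 2.
have k0 : 0 < k by rewrite /k; lra.
have kk0 : 0 < k * k by exact: mulr_gt0.
pose e := Num.min k (eta * (k * k) / 16).
have e0 : 0 < e.
  by rewrite lt_min k0 /=; apply: divr_gt0 => //; exact: mulr_gt0.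
have ek : e <= k by rewrite ge_min lexx.
have ee : e <= eta * (k * k) / 16 by rewrite ge_min lexx orbT.
exists e => // q' u' hq hu.
have q'k : N q' <= 1 - k.
  by have := le_normcD (q' - q) q; rewrite subrK /k in ek *; lra.
have u'k : N u' <= 1 - k.
  by have := le_normcD (u' - u) u; rewrite subrK /k in ek *; lra.
have q'1 : N q' < 1 by lra.
have u'1 : N u' < 1 by lra.
split=> //.
have den x y : N x <= 1 - k -> N y < 1 -> k <= N (1 - x^* * y).
  move=> xk y1; have := lerB_normcB 1 (x^* * y); rewrite normc1 normcM normc_conj.
  by have := ler_piMr (normc_ge0 x) (ltW y1); lra.
have d' := den _ _ q'k u'1.
have d : k <= N (1 - q^* * u) by apply: den => //; rewrite /k; lra.
have dn' : 1 - q'^* * u' != 0 by rewrite -normc_gt0; lra.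
have dn : 1 - q^* * u != 0 by rewrite -normc_gt0; lra.
have -> : mobius q' u' - mobius q u =
  (((u' - u) - (q' - q)) * (1 - q^* * u) +
   (u - q) * ((q'^* - q^*) * u' + q^* * (u' - u))) /
  ((1 - q'^* * u') * (1 - q^* * u)).
  by rewrite /mobius; field; rewrite dn dn'.
rewrite normcM normcV normcM ltr_pdivrMr; last by rewrite mulr_gt0 // normc_gt0.
have D : k * k <= N (1 - q'^* * u') * N (1 - q^* * u).
  by apply: ler_pM => //; exact: ltW.
apply: (@lt_le_trans _ _ (eta * (k * k))); last by apply: ler_wpM2l => //; exact: ltW.
apply: (@le_lt_trans _ _ (8 * e)); last by lra.
apply: le_trans (le_normcD _ _) _; rewrite !normcM.
have a1 : N (u' - u - (q' - q)) <= 2 * e by apply: le_trans (le_normcB _ _) _; lra.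
have a2 : N (1 - q^* * u) <= 2.
  apply: le_trans (le_normcB _ _) _; rewrite normc1 normcM normc_conj.
  by have := ler_piMr (normc_ge0 q) (ltW u1); lra.
have a3 : N (u - q) <= 2 by apply: le_trans (le_normcB _ _) _; lra.
have a4 : N ((q'^* - q^*) * u' + q^* * (u' - u)) <= 2 * e.
  apply: le_trans (le_normcD _ _) _; rewrite !normcM -rmorphB !normc_conj.
  have := ler_piMr (normc_ge0 (q' - q)) (ltW u'1).
  have := ler_piMl (normc_ge0 (u' - u)) (ltW q1); lra.
have b1 : N (u' - u - (q' - q)) * N (1 - q^* * u) <= 2 * e * 2.
  by apply: ler_pM => //; exact: normc_ge0.
have b2 : N (u - q) * N ((q'^* - q^*) * u' + q^* * (u' - u)) <= 2 * (2 * e).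
  by apply: ler_pM => //; exact: normc_ge0.
lra.
Qed.

Lemma uniform_eps (T : eqType) (s : seq T) (P : T -> R -> Prop) :
  (forall x e e', P x e -> e' <= e -> P x e') ->
  (forall x, x \in s -> exists2 e : R, 0 < e & P x e) ->
  exists2 e : R, 0 < e & forall x, x \in s -> P x e.
Proof.
move=> mono; elim: s => [|a s IH] H; first by exists 1.
have [|e e0 he] := IH; first by move=> x xs; apply: H; rewrite in_cons xs orbT.
have [e' e'0 he'] := H a (mem_head _ _).
exists (Num.min e e') => [|x]; first by rewrite lt_min e0.
rewrite in_cons => /predU1P [->|xs].
  by apply: mono he' _; rewrite ge_min lexx orbT.
by apply: mono (he _ xs) _; rewrite ge_min lexx.
Qed.

(** The Schur algorithm. If |g(p)| = 1 then g is constant, a Blaschke product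
    of degree 0. Otherwise write mobius (g p) o g = mobius p * g2: a Blaschke
    product g2 makes g one of degree one more, and when nearby values can be
    prescribed for g2, the inverse transformation, which is continuous in the
    data, prescribes nearby values for g. *)
Lemma interpolation_dichotomy (lam : seq C) g :
  (forall z, N z < 1 -> cdiff g z) -> (forall z, N z < 1 -> N (g z) <= 1) ->
  uniq lam -> (forall x, x \in lam -> N x < 1) ->
  (exists2 d, (d < size lam)%N & blaschke_product d g) \/
  (exists2 e : R, 0 < e & forall w : C -> C,
     (forall x, x \in lam -> N (w x - g x) < e) ->
     exists h, [/\ forall z, N z < 1 -> cdiff h z,
       forall z, N z < 1 -> N (h z) <= 1 &
       forall x, x \in lam -> h x = w x]).
Proof.
elim: lam g => [|p lam IH] g gd gM.
  move=> _ _; right; exists 1 => // w _; exists (fun=> 0 : C); split=> //.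
  by move=> z _; rewrite normc0.
rewrite /= => /andP[plam lamu] l1.
have p1 : N p < 1 by apply: l1; rewrite mem_head.
have l1' x : x \in lam -> N x < 1 by move=> xl; apply: l1; rewrite in_cons xl orbT.
have mx x : x \in lam -> mobius p x != 0.
  move=> xl; rewrite mobius_eq0 //; last exact/ltW/l1'.
  by apply: contraNneq plam => <-.
pose q := g p.
have [q1|q1] := eqVneq (N q) 1.
  left; exists 0%N => //; apply/blaschkeP; exists q, (fun=> 0); split=> //.
    by move=> _; rewrite normc0.
  by move=> w w1; rewrite big_ord0 mulr1; exact: strong_maximum_disc q1 _ w1.
have {}q1 : N q < 1 by rewrite lt_neqAle q1 gM.
have g1 z : N z < 1 -> N (g z) < 1.
  move=> z1; rewrite lt_neqAle gM // andbT; apply/eqP => gz1.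
  by move: q1; rewrite /q (strong_maximum_disc gd gM z1 gz1 p1) gz1 ltxx.
have [|||g2 [g2d g2M g2e]] := @schwarz_quotient_at (fun z => mobius q (g z)) 1 p _ _ p1 _.
- move=> z z1; apply: (@cdiff_comp R (mobius q) g); first exact: gd.
  by apply: cdiff_mobius => //; exact: gM.
- by move=> z z1; apply: mobius_le1 => //; exact: gM.
- exact: mobiusxx.
have [[d dl g2b]|[e2 e20 he2]] := IH g2 g2d g2M lamu l1'.
  left; exists d.+1 => //.
  have := blaschke_mul p1 g2b g2e.
  have q1' : N (- q) < 1 by rewrite normcN.
  move=> /(blaschke_mobius q1'); apply: blaschke_ext => w w1.
  by rewrite mobiusK // gM.
right.
(* Values within e of g p and g x yield a target for g2 within e2 of g2 x. *)
pose P x (e : R) := forall q' u', N (q' - q) < e -> N (u' - g x) < e ->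
    [/\ N q' < 1, N u' < 1 & N (mobius q' u' / mobius p x - g2 x) < e2].
have [||e e0 he] := @uniform_eps C lam P.
- move=> x e e' H ee q' u' h1 h2; apply: H; exact: lt_le_trans ee.
- move=> x xl; have x1 := l1' _ xl.
  have m0 : 0 < N (mobius p x) by rewrite normc_gt0 mx.
  have [e e0 he] := mobius_cont q1 (g1 _ x1) (mulr_gt0 e20 m0).
  exists e => // q' u' h1 h2; have [? ? h3] := he _ _ h1 h2; split=> //.
  have -> : g2 x = mobius q (g x) / mobius p x by rewrite g2e // mulrC mulKf // mx.
  by rewrite -mulrBl normcM normcV ltr_pdivrMr.
exists (Num.min e (1 - N q)); first by rewrite lt_min e0 subr_gt0.
move=> w hw; pose q' := w p.
have hp : N (q' - q) < Num.min e (1 - N q) by apply: hw; rewrite mem_head.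
have [hp1 hp2] : N (q' - q) < e /\ N (q' - q) < 1 - N q.
  by move: hp; rewrite lt_min => /andP.
have q'1 : N q' < 1 by have := le_normcD (q' - q) q; rewrite subrK; lra.
have hx x : x \in lam -> [/\ N q' < 1, N (w x) < 1 &
    N (mobius q' (w x) / mobius p x - g2 x) < e2].
  move=> xl; apply: he => //.
  have := hw x; rewrite in_cons xl orbT => /(_ isT).
  by rewrite lt_min => /andP[].
have [|h2 [h2d h2M h2e]] := he2 (fun x => mobius q' (w x) / mobius p x).
  by move=> x /hx [].
have q'1' : N (- q') < 1 by rewrite normcN.
have ph z : N z < 1 -> N (mobius p z * h2 z) <= 1.
  move=> z1; rewrite normcM mulr_ile1 ?normc_ge0 //; last exact: h2M.
  exact/ltW/mobius_lt1.
exists (fun z => mobius (- q') (mobius p z * h2 z)); split.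
- move=> z z1; apply: (@cdiff_comp R (mobius (- q')) (fun z => mobius p z * h2 z)).
    by apply: cdiffM; [apply: cdiff_mobius => //; exact: ltW|exact: h2d].
  by apply: cdiff_mobius => //; exact: ph.
- by move=> z z1; apply: mobius_le1 => //; exact: ph.
- move=> x; rewrite in_cons => /predU1P [->|xl].
    by rewrite mobiusxx mul0r /mobius mulr0 subr0 divr1 sub0r opprK.
  have [_ wx1 _] := hx _ xl.
  by rewrite h2e // mulrC divfK ?mx // mobiusK // ltW.
Qed.

End Interp.

(** * Extremal functions and the two distances *)

Section Final.
Variable R : realType.
Local Notation C := R[i].

Lemma mobius_distE (u v : C) : mobius_dist u v = N (mobius u v).
Proof. by rewrite /mobius_dist /mobius !normcM (normcBC u). Qed.

(** The right-hand side depends on c only through |c|^2. *)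
Lemma mobius_scale_sqr (c a b : C) :
  N (mobius (c * a) (c * b)) ^+ 2 =
  N c ^+ 2 * N (b - a) ^+ 2 / N (1 - (N c ^+ 2)%:C%C * (a^* * b)) ^+ 2.
Proof.
have e : 1 - (N c ^+ 2)%:C%C * (a^* * b) = 1 - (c * a)^* * (c * b).
  by rewrite sqr_normc_conj rmorphM; ring.
by rewrite e /mobius -mulrBr normcM normcV normcM -!exprMn -exprVn -exprMn.
Qed.

(** With s = |c|^2 and k = conj a * b, the square of the left-hand side is |b
    - a|^2 / (1/s - 2 Re k + s |k|^2), and 1/s + s |k|^2 decreases as long as
    s |k| < 1. *)
Lemma mobius_scale_lt (c c' a b : C) : a != b -> N c < N c' ->
  N (c' * a) < 1 -> N (c' * b) < 1 ->
  N (mobius (c * a) (c * b)) < N (mobius (c' * a) (c' * b)).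
Proof.
move=> ab cc a1 b1.
have c0 := normc_ge0 c; have c'0 : 0 < N c' by apply: le_lt_trans cc.
have ca1 : N (c * a) < 1.
  apply: le_lt_trans a1; rewrite !normcM; apply: ler_wpM2r; last exact: ltW.
  exact: normc_ge0.
have cb1 : N (c * b) < 1.
  apply: le_lt_trans b1; rewrite !normcM; apply: ler_wpM2r; last exact: ltW.
  exact: normc_ge0.
rewrite -(@ltr_pXn2r _ 2) ?nnegrE ?normc_ge0 // !mobius_scale_sqr.
have dn (x : C) : N (x * a) < 1 -> N (x * b) < 1 ->
    0 < N (1 - (N x ^+ 2)%:C%C * (a^* * b)) ^+ 2.
  move=> h1 h2; rewrite exprn_gt0 // normc_gt0.
  have -> : 1 - (N x ^+ 2)%:C%C * (a^* * b) = 1 - (x * a)^* * (x * b).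
    by rewrite sqr_normc_conj rmorphM; ring.
  by apply: mobius_den_neq0 => //; exact: ltW.
have d := dn _ ca1 cb1; have d' := dn _ a1 b1.
rewrite ltr_pdivrMr // [ltRHS]mulrAC ltr_pdivlMr //.
have E0 : 0 < N (b - a) ^+ 2 by rewrite exprn_gt0 // normc_gt0 subr_eq0 eq_sym.
have GE (s : R) : N (1 - s%:C%C * (a^* * b)) ^+ 2 =
   1 - 2 * s * Re (a^* * b) + s ^+ 2 * N (a^* * b) ^+ 2.
  rewrite !sqr_normcE; case: (a^* * b) => x y /=; ring.
rewrite !GE; set k := Re _; set K := N (a^* * b) ^+ 2.
set s := N c ^+ 2; set s' := N c' ^+ 2; set E := N (b - a) ^+ 2 in E0 *.
have ss' : s < s' by rewrite /s /s' ltr_pXn2r ?nnegrE ?normc_ge0.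
have s0 : 0 <= s by exact: sqr_ge0.
have K0 : 0 <= K by exact: sqr_ge0.
have sK : s' ^+ 2 * K < 1.
  have -> : s' ^+ 2 * K = (N (c' * a) * N (c' * b)) ^+ 2.
    by rewrite /s' /K !normcM normc_conj; ring.
  rewrite sqr_lt1; last by rewrite mulr_ge0 ?normc_ge0.
  by apply: le_lt_trans a1; apply: ler_piMr; [exact: normc_ge0|exact: ltW].
have ssK : s * s' * K < 1.
  apply: le_lt_trans sK; apply: ler_wpM2r => //; rewrite expr2.
  by apply: ler_wpM2r; [exact: sqr_ge0|exact: ltW].
have main : 0 < (s' - s) * (1 - s * s' * K) by apply: mulr_gt0; lra.
have : 0 < (s' - s) * (1 - s * s' * K) * E by exact: mulr_gt0.
lra.
Qed.

Lemma mobius_scale_le (c c' a b : C) : N c <= N c' ->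
  N (c' * a) < 1 -> N (c' * b) < 1 ->
  N (mobius (c * a) (c * b)) <= N (mobius (c' * a) (c' * b)).
Proof.
move=> cc a1 b1; have [->|ab] := eqVneq a b.
  by rewrite !mobiusxx.
move: cc; rewrite le_eqVlt => /orP[/eqP e|lt]; last exact/ltW/mobius_scale_lt.
rewrite -(@ler_pXn2r _ 2) ?nnegrE ?normc_ge0 //.
by rewrite !mobius_scale_sqr e.
Qed.

Section Domain.
Variables (V : normedModType R[i]) (n : nat) (alpha : 'rV[R[i]]_n).
Implicit Types (X : set V) (z : 'I_n -> V).

Lemma values_in_lineP (W : normedModType R[i]) (z : 'I_n -> W) (f : W -> R[i]^o) :
  values_in_line z alpha f <-> exists c : C, forall k, f (z k) = c * alpha 0 k.
Proof.
split=> -[c h]; exists c.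
  by move=> k; have /rowP /(_ k) := h; rewrite !mxE.
by apply/rowP => k; rewrite !mxE h.
Qed.

Lemma d_dist_set_sup (W : normedModType R[i]) (X : set W) (z : 'I_n -> W) i j :
  (forall k, X (z k)) ->
  has_sup [set mobius_dist (f (z i)) (f (z j)) |
        f in [set f | holo X (disc R) f /\ values_in_line z alpha f]].
Proof.
move=> Xz; split.
  exists (mobius_dist (0 : C) (0 : C)); exists (fun=> 0) => //; split.
    split=> x _; first exact: differentiable_cst.
    by rewrite disc_normc normc0.
  by apply/values_in_lineP; exists 0 => k; rewrite mul0r.
exists 1 => _ [f [[_ fD] _] <-]; rewrite mobius_distE.
by apply/ltW/mobius_lt1; rewrite -disc_normc; apply: fD.
Qed.

Lemma le_d_dist (W : normedModType R[i]) (X : set W) (z : 'I_n -> W) i j f :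
  (forall k, X (z k)) -> holo X (disc R) f -> values_in_line z alpha f ->
  mobius_dist (f (z i)) (f (z j)) <= d_dist X z alpha i j.
Proof.
move=> Xz fh fl; apply: sup_upper_bound; first exact: d_dist_set_sup.
by exists f.
Qed.

Lemma d_dist_le (W : normedModType R[i]) (X : set W) (z : 'I_n -> W) i j (b : R) :
  (forall k, X (z k)) ->
  (forall f, holo X (disc R) f -> values_in_line z alpha f ->
     mobius_dist (f (z i)) (f (z j)) <= b) ->
  d_dist X z alpha i j <= b.
Proof.
move=> Xz H; apply: ge_sup; first by have [] := d_dist_set_sup i j Xz.
by move=> _ [f [fh fl] <-]; exact: H.
Qed.

Lemma d_dist_lifting X z lambda i j : liftings X z lambda ->
  d_dist X z alpha i j <= d_dist (disc R) lambda alpha i j.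
Proof.
move=> [lD [phi [phid phiX] phil]].
apply: d_dist_le => [k|f [fd fD] /values_in_lineP [c fl]].
  by rewrite -phil; apply: phiX.
rewrite -!phil; apply: (@le_d_dist _ (disc R) lambda i j (f \o phi)) => //.
  split=> x xD; last by apply: fD; exact: phiX.
  apply: differentiable_comp; first exact: phid.
  by apply: fd; exact: phiX.
by apply/values_in_lineP; exists c => k; rewrite /= phil.
Qed.

Lemma delta_dist_ge X z i j b : (exists lambda, liftings X z lambda) ->
  (forall lambda, liftings X z lambda ->
     b <= d_dist (disc R) lambda alpha i j) -> b <= delta_dist X z alpha i j.
Proof.
move=> [l ll] H; apply: lb_le_inf.
  by exists (d_dist (disc R) l alpha i j); exists l.
by move=> _ [l' h <-]; exact: H.
Qed.

Lemma delta_dist_le X z i j lambda : liftings X z lambda ->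
  delta_dist X z alpha i j <= d_dist (disc R) lambda alpha i j.
Proof.
move=> ll; apply: ge_inf; last by exists lambda.
exists (d_dist X z alpha i j) => _ [l h <-]; exact: d_dist_lifting.
Qed.

Lemma lifting_inj X z lambda : injective z -> liftings X z lambda -> injective lambda.
Proof.
by move=> zi [_ [phi _ h]] i j e; apply: zi; rewrite -!h e.
Qed.

(** Competitors for the lifting lambda that do better than f o phi would
    contradict the rigidity of Blaschke products, so f o phi is extremal for
    lambda and f is extremal on X: all inequalities between the distances
    become equalities. *)
Lemma blaschke_attained X z (phi : R[i]^o -> V) (f : V -> R[i]^o) d :
  injective z -> (0 < n)%N ->
  holo (disc R) X phi -> holo X (disc R) f -> values_in_line z alpha f ->
  (forall k, (phi @` disc R) (z k)) -> (d <= n.-1)%N ->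
  blaschke_product d (f \o phi) ->
  forall k l, attained_equality X z alpha k l.
Proof.
move=> zi n0 [phid phiX] [fd fD] fl.
move=> fz dn Bb.
have /choice [lambda hl] : forall k, exists l, disc R l /\ phi l = z k.
  by move=> k; have [l h1 h2] := fz k; exists l.
have lD k : disc R (lambda k) by have [] := hl k.
have lz k : phi (lambda k) = z k by have [] := hl k.
have ll : liftings X z lambda by split=> //; exists phi.
have Xz k : X (z k) by rewrite -lz; exact: phiX.
have li := lifting_inj zi ll.
have gh : holo (disc R) (disc R) (f \o phi).
  split=> x xD; last by apply: fD; exact: phiX.
  by apply: differentiable_comp; [exact: phid|apply: fd; exact: phiX].
have /values_in_lineP [c fc] := fl.
have gl : values_in_line lambda alpha (f \o phi).
  by apply/values_in_lineP; exists c => k; rewrite /= lz.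
have dle k l : d_dist (disc R) lambda alpha k l <= mobius_dist (f (z k)) (f (z l)).
  apply: d_dist_le => // h [hd hD] /values_in_lineP [c' hc].
  rewrite !fc !hc !mobius_distE; apply: mobius_scale_le; last first.
  - by rewrite -fc -disc_normc; exact: fD.
  - by rewrite -fc -disc_normc; exact: fD.
  rewrite leNgt; apply/negP => cc.
  have c'0 : c' != 0 by rewrite -normc_gt0; apply: le_lt_trans cc; exact: normc_ge0.
  pose lam := [seq lambda k | k <- enum 'I_n].
  apply: (@blaschke_interpolation_rigid R d (f \o phi)
    (fun x => c / c' * h x) (N c / N c') lam Bb).
  - by rewrite ltr_pdivrMr ?normc_gt0 // mul1r.
  - move=> x x1; apply: cdiffM; first exact: cdiff_cst.
    by apply: hd; rewrite disc_normc.
  - move=> x x1; rewrite normcM normcM normcV; apply: ler_piMr.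
      by rewrite divr_ge0 ?normc_ge0.
    by apply/ltW; rewrite -disc_normc; apply: hD; rewrite disc_normc.
  - by rewrite map_inj_uniq ?enum_uniq.
  - by rewrite size_map size_enum_ord -(prednK n0) ltnS.
  - by move=> _ /mapP [m _ ->]; rewrite -disc_normc.
  - by move=> _ /mapP [m _ ->]; rewrite /= lz fc hc mulrA divfK.
move=> k l.
have h1 := delta_dist_le k l ll.
have h2 : d_dist X z alpha k l <= delta_dist X z alpha k l.
  by apply: delta_dist_ge => [|l' hl']; [exists lambda|exact: d_dist_lifting].
have h3 := le_d_dist k l Xz (conj fd fD) fl.
have h4 := dle k l.
split; last by apply/le_anti; rewrite h2 /=; apply: le_trans h1 _; exact: le_trans h3.
exists lambda => //; apply/le_anti; rewrite h1 andbT.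
by apply: le_trans h4 _; apply: le_trans h3 _.
Qed.

(** A limit of a maximising sequence. The condition of being proportional to
    alpha is closed, as it says that the vectors have vanishing 2 x 2 minors.
    A limit taking a value of modulus 1 would be constant and nonzero, which
    contradicts alpha_i <> alpha_j; so the limit maps into the open disc,
    where the distance is continuous. *)
Lemma extremal_exists X z i j : open X -> connected X -> (forall k, X (z k)) ->
  alpha 0 i <> alpha 0 j ->
  exists f, [/\ holo X (disc R) f, values_in_line z alpha f &
    mobius_dist (f (z i)) (f (z j)) = d_dist X z alpha i j].
Proof.
move=> Xo Xc Xz aij; set s := d_dist X z alpha i j.
have [m0 ao] : exists m0, alpha 0 m0 != 0.
  have [ai|ai] := eqVneq (alpha 0 i) 0; last by exists i.
  by exists j; apply/eqP => aj; apply: aij; rewrite ai.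
have /choice [fs hfs] : forall n : nat, exists f : V -> R[i]^o,
   [/\ holo X (disc R) f, values_in_line z alpha f &
     s - n.+1%:R^-1 < mobius_dist (f (z i)) (f (z j))].
  move=> m; have e0 : 0 < m.+1%:R^-1 :> R by rewrite invr_gt0 ltr0n.
  have [_ [f [fh fl] <-] h] := sup_adherent e0 (d_dist_set_sup i j Xz).
  by exists f.
have [U [UU Uo]] := ultrafilter_nat.
have fs1 m x : X x -> N (fs m x) < 1.
  by move=> Xx; rewrite -disc_normc; have [[_ H] _ _] := hfs m; exact: H.
have /choice [f hf] : forall x, exists l : R[i]^o, X x -> forall e, 0 < e ->
    U [set n | N (fs n x - l) < e].
  move=> x; have [Xx|Xx] := pselect (X x); last by exists 0.
  by have [l hl] := ultra_limit (U := U) (fun m => ltW (fs1 m x Xx)); exists l.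
have fsX m x : X x -> differentiable (fs m) x /\ N (fs m x) <= 1.
  by move=> Xx; have [[H _] _ _] := hfs m; split; [exact: H|exact/ltW/fs1].
have fd := montel_ultra_limit Xo fsX hf.
have f1 x : X x -> N (f x) <= 1.
  move=> Xx; rewrite -[f x]subr0; apply: (ultra_limit_le (hf x Xx)).
  by apply: filterS (@filterT _ U _) => m _ /=; rewrite subr0; apply/ltW/fs1.
have cross k : f (z k) * alpha 0 m0 = f (z m0) * alpha 0 k.
  apply/eqP; rewrite -subr_eq0 -normc_eq0; apply/eqP/le_anti; rewrite normc_ge0 andbT.
  apply/ler_addgt0Pr => e e0; rewrite add0r.
  pose A := N (alpha 0 m0) + N (alpha 0 k) + 1.
  have a0 := normc_ge0 (alpha 0 m0); have a1 := normc_ge0 (alpha 0 k).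
  have A0 : 0 < A by rewrite /A; lra.
  have eA : 0 < e / A by exact: divr_gt0.
  have [m [/= h1 h2]] := filter_ex (filterI (hf _ (Xz k) _ eA) (hf _ (Xz m0) _ eA)).
  have [_ /values_in_lineP [c hc] _] := hfs m.
  have -> : f (z k) * alpha 0 m0 - f (z m0) * alpha 0 k =
     (fs m (z m0) - f (z m0)) * alpha 0 k - (fs m (z k) - f (z k)) * alpha 0 m0.
    by rewrite !hc; ring.
  apply: le_trans (le_normcB _ _) _; rewrite !normcM.
  have b1 := ler_wpM2r a1 (ltW h2); have b2 := ler_wpM2r a0 (ltW h1).
  have : e / A * A = e by rewrite divfK // gt_eqF.
  by rewrite {2}/A; lra.
have fl : forall k, f (z k) = f (z m0) / alpha 0 m0 * alpha 0 k.
  by move=> k; rewrite mulrAC -cross mulfK.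
set c := f (z m0) / alpha 0 m0 in fl.
have fD x : X x -> N (f x) < 1.
  move=> Xx; rewrite lt_neqAle f1 // andbT; apply/eqP => fx1.
  have fX y : X y -> differentiable f y /\ N (f y) <= 1.
    by move=> Xy; split; [exact: fd|exact: f1].
  have fconst := strong_maximum_domain Xo Xc fX Xx fx1.
  have e : c * alpha 0 i = c * alpha 0 j by rewrite -!fl !fconst.
  have [c0|c0] := eqVneq c 0; last by apply: aij; exact: (mulfI c0).
  have := fx1; rewrite -(fconst _ (Xz i)) fl c0 mul0r normc0; lra.
exists f; split.
- by split=> x Xx; [exact: fd|rewrite disc_normc fD].
- by apply/values_in_lineP; exists c.
apply/eqP; rewrite -subr_eq0 -normr_eq0; apply/eqP/le_anti; rewrite normr_ge0 andbT.
apply/ler_addgt0Pr => e e0; rewrite add0r.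
have e2 : 0 < e / 2 by lra.
have [e' e'0 he'] := mobius_cont (fD _ (Xz i)) (fD _ (Xz j)) e2.
have Ue : U [set n | n.+1%:R^-1 < e / 2].
  apply: Uo; exists (Num.truncn (e / 2)^-1) => // m /= hm.
  rewrite invf_plt ?posrE ?ltr0n //.
  by apply: lt_le_trans (truncnS_gt _) _; rewrite ler_nat ltnS.
have [m [/= [h1 h2] h3]] := filter_ex
  (filterI (filterI (hf _ (Xz i) _ e'0) (hf _ (Xz j) _ e'0)) Ue).
have [_ _ h4] := he' _ _ h1 h2.
have [fh fsl h5] := hfs m.
have h6 := le_d_dist i j Xz fh fsl; rewrite -/s in h6.
move: h5 h6; rewrite !mobius_distE => h5 h6.
have h7 := lerB_normcB (mobius (fs m (z i)) (fs m (z j))) (mobius (f (z i)) (f (z j))).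
have h8 := lerB_normcB (mobius (f (z i)) (f (z j))) (mobius (fs m (z i)) (fs m (z j))).
rewrite (normcBC (mobius (f (z i)) (f (z j)))) in h8.
move: (m.+1%:R^-1 : R) h3 h5 => y h3 h5.
rewrite ler_norml; apply/andP; split; lra.
Qed.

Lemma larger_scalar (c : C) (d : R) : 0 < d ->
  exists2 c', N (c' - c) < d & N c < N c'.
Proof.
move=> d0; have d2 : 0 < d / 2 by lra.
have [->|c0] := eqVneq c 0.
  have Nd : N (d / 2)%:C%C = d / 2 by rewrite normc_real gtr0_norm.
  by exists (d / 2)%:C%C; rewrite ?subr0 ?normc0 Nd //; lra.
have Nc : 0 < N c by rewrite normc_gt0.
have q0 : 0 < d / 2 / N c by exact: divr_gt0.
exists (c + (d / 2 / N c)%:C%C * c).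
  by rewrite addrC addKr normcM normc_real gtr0_norm // divfK ?gt_eqF //; lra.
have -> : c + (d / 2 / N c)%:C%C * c = (1 + d / 2 / N c)%:C%C * c.
  by rewrite rmorphD rmorph1; ring.
rewrite normcM normc_real gtr0_norm; last by lra.
by rewrite mulrDl mul1r divfK ?gt_eqF //; lra.
Qed.

(** If g were not a Blaschke product of degree less than n, the values c'
    alpha_k with |c'| slightly larger than |c| would be interpolable, hence so
    would t c' alpha_k by functions into the open disc with t < 1, and t can
    be chosen so that |t c'| > |c|. *)
Lemma extremal_blaschke lambda (g : R[i]^o -> R[i]^o) i j :
  (forall k, disc R (lambda k)) -> injective lambda ->
  alpha 0 i <> alpha 0 j ->
  holo (disc R) (disc R) g -> values_in_line lambda alpha g ->
  mobius_dist (g (lambda i)) (g (lambda j)) = d_dist (disc R) lambda alpha i j ->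
  nonconstant_on (disc R) g /\
  exists2 d : nat, (d <= n.-1)%N & blaschke_product d g.
Proof.
move=> lD li aij [gd gD] /values_in_lineP [c gc] gext.
pose lam := [seq lambda k | k <- enum 'I_n].
have lamu : uniq lam by rewrite map_inj_uniq ?enum_uniq.
have lam1 x : x \in lam -> N x < 1 by move=> /mapP [k _ ->]; rewrite -disc_normc.
have lams : size lam = n by rewrite size_map size_enum_ord.
have mem_lam k : lambda k \in lam by apply: map_f; rewrite mem_enum.
have gd' x : N x < 1 -> cdiff g x by rewrite -disc_normc; exact: gd.
have gM x : N x < 1 -> N (g x) <= 1.
  by move=> x1; apply/ltW; rewrite -disc_normc; apply: gD; rewrite disc_normc.
have [[d dn Bb]|[e e0 he]] := interpolation_dichotomy gd' gM lamu lam1.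
  rewrite lams in dn; split; last first.
    by exists d => //; rewrite -ltnS (ltn_predK dn).
  exists (lambda i), (lambda j); split=> //; rewrite !gc => h.
  have [c0|c0] := eqVneq c 0; last by apply: aij; exact: (mulfI c0).
  apply: (@blaschke_interpolation_rigid R d g (fun=> 0) 0 lam Bb) => //.
  - by move=> x _; rewrite normc0.
  - by rewrite lams.
  - by move=> _ /mapP [k _ ->]; rewrite gc c0 mul0r.
exfalso.
pose A := 1 + \sum_(k < n) N (alpha 0 k).
have A0 : 0 < A by rewrite ltr_pwDl // sumr_ge0 // => k _; exact: normc_ge0.
have aA k : N (alpha 0 k) <= A.
  rewrite /A (bigD1 k) //= addrCA lerDl addr_ge0 // sumr_ge0 // => l _.
  exact: normc_ge0.
have [c' cc' Nc] := larger_scalar c (divr_gt0 e0 A0).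
pose w (x : C) : C := if [pick k | lambda k == x] is Some k then c' * alpha 0 k else 0.
have wl k : w (lambda k) = c' * alpha 0 k.
  rewrite /w; case: pickP => [l /eqP /li -> //|/(_ k)].
  by rewrite eqxx.
have [|h [hd hM hw]] := he w.
  move=> _ /mapP [k _ ->]; rewrite wl gc -mulrBl normcM.
  apply: (@le_lt_trans _ _ (N (c' - c) * A)).
    by apply: ler_wpM2l; [exact: normc_ge0|exact: aA].
  by rewrite -ltr_pdivlMr.
have c'0 : 0 < N c' by apply: le_lt_trans Nc; exact: normc_ge0.
(* The midpoint of N c / N c' and 1: then t < 1 and N c < t * N c'. *)
pose t : R := (1 + N c / N c') / 2.
have q1 : N c / N c' < 1 by rewrite ltr_pdivrMr // mul1r.
have q0 : 0 <= N c / N c' by rewrite divr_ge0 ?normc_ge0.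
have t0 : 0 < t by rewrite /t; lra.
have t1 : t < 1 by rewrite /t; lra.
pose h' (x : R[i]^o) : R[i]^o := t%:C%C * h x.
have Nt : N t%:C%C = t by rewrite normc_real gtr0_norm.
have h'h : holo (disc R) (disc R) h'.
  split=> x; rewrite !disc_normc => x1.
    by apply: cdiffM; [exact: cdiff_cst|exact: hd].
  by rewrite normcM Nt; apply: le_lt_trans t1; apply: ler_piMr; [exact: ltW|exact: hM].
have h'c k : h' (lambda k) = t%:C%C * c' * alpha 0 k.
  by rewrite /h' hw // wl mulrA.
have h'l : values_in_line lambda alpha h'.
  by apply/values_in_lineP; exists (t%:C%C * c').
have := le_d_dist i j lD h'h h'l.
rewrite -gext !h'c !gc !mobius_distE leNgt => /negP; apply.
apply: mobius_scale_lt.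
- exact/eqP.
- rewrite normcM Nt /t.
  have -> : (1 + N c / N c') / 2 * N c' = (N c' + N c) / 2 by field; rewrite gt_eqF.
  lra.
- by rewrite -h'c -disc_normc; have [_] := h'h; apply.
- by rewrite -h'c -disc_normc; have [_] := h'h; apply.
Qed.

End Domain.

End Final.

Theorem theorem2p6 (R : realType) (m n : nat) (m_gt0 : (0 < m)%N)
    (Omega : set 'rV[R[i]^o]_m) (domOmega : domain Omega)
    (hypOmega : caratheodory_hyperbolic Omega)
    (z : 'I_n -> 'rV[R[i]^o]_m) (Omega_z : forall k, Omega (z k))
    (z_inj : injective z)
    (alpha : 'rV[R[i]]_n) (alpha_neq0 : alpha <> 0)
    (alpha_neq : exists i j, alpha 0 i <> alpha 0 j) :
  ((exists i j, alpha 0 i <> alpha 0 j /\ attained_equality Omega z alpha i j)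
   <->
   (exists (phi : R[i]^o -> 'rV[R[i]^o]_m) (f : 'rV[R[i]^o]_m -> R[i]^o),
      [/\ holo (disc R) Omega phi, holo Omega (disc R) f,
          values_in_line z alpha f,
          forall k, (phi @` disc R) (z k)
        & nonconstant_on (disc R) (f \o phi) /\
          exists2 d : nat, (d <= n.-1)%N & blaschke_product d (f \o phi)]))
  /\
  (forall i j, alpha 0 i <> alpha 0 j -> attained_equality Omega z alpha i j ->
   forall k l, attained_equality Omega z alpha k l).
Proof.
have [i0 [j0 aij0]] := alpha_neq.
have n_gt0 : (0 < n)%N by apply: leq_trans (ltn_ord i0).
have [_ Oo Oc] := domOmega.
set blaschke_pair := (X in (_ <-> X) /\ _).
have fwd i j : alpha 0 i <> alpha 0 j ->
    attained_equality Omega z alpha i j -> blaschke_pair.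
  move=> aij [[lambda ll ld] dd].
  have li := lifting_inj z_inj ll.
  have [lD [phi phih lz]] := ll.
  have [f [fh fl fext]] := extremal_exists Oo Oc Omega_z aij.
  exists phi, f; split=> //.
    by move=> k; exists (lambda k).
  apply: (extremal_blaschke lD li aij).
  - have [phid phiO] := phih; have [fd fD] := fh.
    split=> x xD; last by apply: fD; exact: phiO.
    by apply: differentiable_comp; [exact: phid|apply: fd; exact: phiO].
  - have /values_in_lineP [c fc] := fl.
    by apply/values_in_lineP; exists c => k; rewrite /= lz.
  - by rewrite /= !lz fext dd -ld.
have bwd : blaschke_pair -> forall k l, attained_equality Omega z alpha k l.
  move=> [phi [f [phih fh fl fz [_ [d dn Bb]]]]].
  exact: blaschke_attained Bb.
split; last by move=> i j aij /(fwd i j aij) /bwd.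
split=> [[i [j [aij h]]]|/bwd h]; first exact: fwd h.
by exists i0, j0.
Qed.
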